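(* Let $V$ be a finite-dimensional $Y_\hbar(\mathfrak g)$-module. Then $$\sigma_i(V)=\sigma_i(\chi_q(V))=\sigma(\chi_q(\varphi_i^*(V)))\quad\text{for all } i\in\mathbf I.$$
   Context: Let $\mathfrak g$ be a finite-dimensional simple Lie algebra over $\mathbb C$ with Cartan subalgebra $\mathfrak h$, simple roots $\{\alpha_i\}_{i\in\mathbf I}$, invariant form $(\cdot,\cdot)$ normalized so that short roots have squared length $2$, Cartan matrix $a_{ij}=2(\alpha_i,\alpha_j)/(\alpha_i,\alpha_i)$, and $d_i=(\alpha_i,\alpha_i)/2$. Fix $\hbar\in\mathbb C^\times$. The Yangian $Y_\hbar(\mathfrak g)$ is the unital associative $\mathbb C$-algebra generated by $\xi_{i,r},x_{i,r}^\pm$ ($i\in\mathbf I$, $r\in\mathbb Z_{\ge0}$) with relations, for all $i,j\in\mathbf I$, $r,s\ge0$: $[\xi_{i,r},\xi_{j,s}]=0$; $[\xi_{i,0},x_{j,s}^\pm]=\pm d_ia_{ij}x_{j,s}^\pm$; $[\xi_{i,r+1},x_{j,s}^\pm]-[\xi_{i,r},x_{j,s+1}^\pm]=\pm\hbar\frac{d_ia_{ij}}2(\xi_{i,r}x_{j,s}^\pm+x_{j,s}^\pm\xi_{i,r})$; $[x^\pm_{i,r+1},x_{j,s}^\pm]-[x^\pm_{i,r},x_{j,s+1}^\pm]=\pm\hbar\frac{d_ia_{ij}}2(x^\pm_{i,r}x_{j,s}^\pm+x_{j,s}^\pm x^\pm_{i,r})$; $[x_{i,r}^+,x_{j,s}^-]=\delta_{ij}\xi_{i,r+s}$;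 and for $i\ne j$, $m=1-a_{ij}$, $\sum_{\pi\in S_m}[x^\pm_{i,r_{\pi(1)}},[x^\pm_{i,r_{\pi(2)}},\cdots[x^\pm_{i,r_{\pi(m)}},x^\pm_{j,s}]\cdots]]=0$. Set $\xi_i(u)=1+\hbar\sum_{r\ge0}\xi_{i,r}u^{-r-1}$, $x_i^\pm(u)=\hbar\sum_{r\ge0}x_{i,r}^\pm u^{-r-1}$. On a finite-dimensional representation $V$ these are expansions at $u=\infty$ of $\mathrm{End}(V)$-valued rational functions; $\sigma_i(V)\subset\mathbb C$ is the set of all poles of $\xi_i(u),x_i^+(u),x_i^-(u)$. For a tuple $\underline\mu=(\mu_i(u))_{i\in\mathbf I}$ with $\mu_i(u)=1+\hbar\sum_{r\ge0}\mu_{i,r}u^{-r-1}$, $V[\underline\mu]$ is the joint generalized eigenspace $\{v\in V:\forall i\in\mathbf I,k\ge0,\ (\xi_{i,k}-\mu_{i,k})^Nv=0\text{ for some }N>0\}$. One has $V=\bigoplus_{\underline\mu}V[\underline\mu]$, and the $q$-character is $\chi_q(V)=\sum_{\underline\mu}\dim(V[\underline\mu])\,e(\underline\mu)$ in the group ring of the group of such tuples. If $V[\underline\mu]\ne0$ then each $\mu_i(u)$ is (the expansion of) a rational function. Define $\sigma_i(\chi_q(V))=\bigcup_{\underline\mu:V[\underline\mu]\neq0}\{\text{poles of }\mu_i(u)\}\subset\mathbb C$, i.e. the set of poles of all eigenvalues of $\xi_i(u)$ on $V$; when $\mathfrak g=\mathfrak{sl}_2$ the subscript $i$ is omitted. For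 $i\in\mathbf I$, $\varphi_i:Y_{d_i\hbar}(\mathfrak{sl}_2)\to Y_\hbar(\mathfrak g)$ is the algebra homomorphism $\varphi_i(\xi(u))=\xi_i(u)$, $\varphi_i(x^\pm(u))=\sqrt{d_i}\,x_i^\pm(u)$ (generators of the Yangian of $\mathfrak{sl}_2$ written without index); it is an isomorphism onto the subalgebra generated by $\xi_{i,r},x_{i,r}^\pm$, $r\ge0$. $\varphi_i^*(V)$ is the pull-back of $V$. *)

(* Defs.v *)
From HB Require Import structures.
From mathcomp Require Import all_boot all_order perm all_algebra.
From mathcomp Require Import boolp classical_sets reals complex ring.
Set Implicit Arguments.
Unset Strict Implicit.
Unset Printing Implicit Defensive.
Import Order.TTheory GRing.Theory Num.Theory.
Local Open Scope ring_scope.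

Record lieAlgebra (F : fieldType) := LieAlgebra {
  lie_vect :> vectType F;
  lie_br : lie_vect -> lie_vect -> lie_vect;
  lie_brDl : forall (a : F) x y z,
    lie_br (a *: x + y) z = a *: lie_br x z + lie_br y z;
  lie_brDr : forall (a : F) x y z,
    lie_br x (a *: y + z) = a *: lie_br x y + lie_br x z;
  lie_brxx : forall x, lie_br x x = 0;
  lie_jacobi : forall x y z,
    lie_br x (lie_br y z) + lie_br y (lie_br z x) + lie_br z (lie_br x y) = 0
}.

Section LieTheory.
Variables (F : fieldType) (L : lieAlgebra F).
Implicit Types (U W H : {vspace L}).

Definition lie_ideal U := forall x y : L, y \in U -> lie_br x y \in U.

Definition lie_simple :=
  (exists x y : L, lie_br x y != 0) /\
  (forall U, lie_ideal U -> U = 0%VS \/ U = fullv).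

Definition lie_comm U W : {vspace L} :=
  <<[seq lie_br x y | x <- vbasis U, y <- vbasis W]>>%VS.

Definition lie_nilpotent U := exists n, iter n (lie_comm U) U = 0%VS.

Definition cartan_subalgebra H :=
  [/\ forall x y : L, x \in H -> y \in H -> lie_br x y \in H,
      lie_nilpotent H
    & forall x : L, (forall y, y \in H -> lie_br x y \in H) -> x \in H].

Definition dual H := 'Hom(subvs_of H, F^o).

Definition is_root H (al : dual H) :=
  al != 0 /\
  exists2 x : L, x != 0 & forall y : subvs_of H,
    lie_br (vsval y) x = (al y : F) *: x.

Definition is_base H (I : finType) (al : I -> dual H) :=
  [/\ forall i, is_root (al i),
      free [seq al i | i : I]
    & forall be : dual H, is_root be -> exists c : I -> nat,
        be = \sum_i al i *+ c i \/ be = - \sum_i al i *+ c i].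

Definition invariant_form (B : L -> L -> F) :=
  [/\ forall (a : F) x y z, B (a *: x + y) z = a * B x z + B y z,
      forall x y, B x y = B y x,
      forall x y z, B (lie_br x y) z = B x (lie_br y z)
    & forall x, (forall y, B x y = 0) -> x = 0].

(* t |-> B t _ as a linear map from H to its dual; it is bijective when H is a
   Cartan subalgebra of a simple Lie algebra and B is an invariant form. *)
Definition form_map (B : L -> L -> F) H : 'Hom(subvs_of H, dual H) :=
  linfun (fun t : subvs_of H =>
    linfun (fun y : subvs_of H => B (vsval t) (vsval y) : F^o) : dual H).

Definition dual_form (B : L -> L -> F) H (al be : dual H) : F :=
  al ((form_map B H)^-1%VF be).

End LieTheory.

(* The form is normalized by the last two fields: squared lengths of roots are
   real and their minimum is 2. *)
Record simpleLie (F : numClosedFieldType) := SimpleLie {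
  sl_alg :> lieAlgebra F;
  sl_simple : lie_simple sl_alg;
  sl_cartan : {vspace sl_alg};
  sl_cartanP : cartan_subalgebra sl_cartan;
  sl_index : finType;
  sl_root : sl_index -> dual sl_cartan;
  sl_rootP : is_base sl_root;
  sl_form : sl_alg -> sl_alg -> F;
  sl_formP : invariant_form sl_form;
  sl_short_ge2 : forall be : dual sl_cartan, is_root be ->
    2 <= dual_form sl_form be be;
  sl_short_eq2 : exists2 be : dual sl_cartan, is_root be &
    dual_form sl_form be be = 2
}.

Record cartanData (F : Type) := CartanData {
  cd_index : finType;
  cd_d : cd_index -> F;
  cd_a : cd_index -> cd_index -> F
}.

Definition cartan_of (F : numClosedFieldType) (g : simpleLie F) :
    cartanData F :=
  let form := dual_form (@sl_form F g) (H := sl_cartan g) in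
  let al := @sl_root F g in
  {| cd_index := sl_index g;
     cd_d := fun i => form (al i) (al i) / 2;
     cd_a := fun i j => 2 * form (al i) (al j) / form (al i) (al i) |}.

(* The only simple root is short, so d = 1. *)
Definition cartan_sl2 (F : numClosedFieldType) : cartanData F :=
  {| cd_index := unit; cd_d := fun _ => 1; cd_a := fun _ _ => 2 |}.

(* Expressions in the generators; [YX true] is x^+ and [YX false] is x^-. *)
Inductive yterm (F I : Type) : Type :=
| YC of F
| YXi of I & nat
| YX of bool & I & nat
| YAdd of yterm F I & yterm F I
| YMul of yterm F I & yterm F I.

Arguments YC {F I}.
Arguments YXi {F I}.
Arguments YX {F I}.

Declare Scope yterm_scope.
Delimit Scope yterm_scope with Y.
Bind Scope yterm_scope with yterm.
Notation "t + u" := (YAdd t u) : yterm_scope.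
Notation "t * u" := (YMul t u) : yterm_scope.
Notation "c *: t" := (YMul (YC c%R) t) : yterm_scope.
Notation "t - u" := (YAdd t (YMul (YC (-1)%R) u)) : yterm_scope.

Definition ybr {F : pzRingType} {I : Type} (t u : yterm F I) : yterm F I :=
  (t * u - u * t)%Y.

Definition pm {F : pzRingType} (b : bool) : F := if b then 1 else -1.

Section Yangian.
Variables (F : numClosedFieldType) (K : cartanData F) (hbar : F).

Local Notation I := (cd_index K).
Local Notation d := (@cd_d F K).
Local Notation a := (@cd_a F K).
Local Notation term := (yterm F I).

(* [a] takes values in [F], hence the equation for [m]. The [foldr] is the
   nested bracket [x_(p 0), [x_(p 1), ... [x_(p (m-1)), x_j]]]. *)
Inductive yrel : term -> term -> Prop :=
| yrel_xixi i j r s :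
    yrel (ybr (YXi i r) (YXi j s)) (YC 0)
| yrel_xi0x b i j s :
    yrel (ybr (YXi i 0) (YX b j s))
         ((pm b * (d i * a i j)) *: YX b j s)%Y
| yrel_xix b i j r s :
    yrel (ybr (YXi i r.+1) (YX b j s) - ybr (YXi i r) (YX b j s.+1))%Y
         ((pm b * hbar * (d i * a i j / 2)) *:
            (YXi i r * YX b j s + YX b j s * YXi i r))%Y
| yrel_xx b i j r s :
    yrel (ybr (YX b i r.+1) (YX b j s) - ybr (YX b i r) (YX b j s.+1))%Y
         ((pm b * hbar * (d i * a i j / 2)) *:
            (YX b i r * YX b j s + YX b j s * YX b i r))%Y
| yrel_xpxm i j r s :
    yrel (ybr (YX true i r) (YX false j s))
         (if i == j then YXi i (r + s) else YC 0)
| yrel_serre b i j m (rr : 'I_m -> nat) s :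
    i != j -> m%:R = 1 - a i j ->
    yrel (\big[@YAdd F I/YC 0]_(p : 'S_m)
            foldr (fun k t => ybr (YX b i (rr (p k))) t)
                  (YX b j s) (enum 'I_m))
         (YC 0).

(* The congruence of unital associative F-algebras generated by [yrel]. *)
Inductive ycong : term -> term -> Prop :=
| ycong_rel t u : yrel t u -> ycong t u
| ycong_refl t : ycong t t
| ycong_sym t u : ycong t u -> ycong u t
| ycong_trans u t v : ycong t u -> ycong u v -> ycong t v
| ycong_add t t' u u' : ycong t t' -> ycong u u' -> ycong (t + u) (t' + u')
| ycong_mul t t' u u' : ycong t t' -> ycong u u' -> ycong (t * u) (t' * u')
| ycong_addA t u v : ycong (t + (u + v)) (t + u + v)
| ycong_addC t u : ycong (t + u) (u + t)
| ycong_mulA t u v : ycong (t * (u * v)) (t * u * v)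
| ycong_mulDl t u v : ycong ((t + u) * v) (t * v + u * v)
| ycong_mulDr t u v : ycong (t * (u + v)) (t * u + t * v)
| ycong_0 t : ycong (YC 0 * t) (YC 0)
| ycong_1 t : ycong (YC 1 * t) t
| ycong_cD x y : ycong (YC (x + y)%R) (YC x + YC y)
| ycong_cM x y : ycong (YC (x * y)%R) (YC x * YC y)
| ycong_cC x t : ycong (YC x * t) (t * YC x).

Section Eval.
Variables (A : algType F) (fxi : I -> nat -> A) (fx : bool -> I -> nat -> A).

Fixpoint yeval (t : term) : A :=
  match t with
  | YC c => c%:A
  | YXi i r => fxi i r
  | YX b i r => fx b i r
  | YAdd t u => yeval t + yeval u
  | YMul t u => yeval t * yeval u
  end.

Lemma yeval_cong :
  (forall t u, yrel t u -> yeval t = yeval u) ->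
  forall t u, ycong t u -> yeval t = yeval u.
Proof.
move=> evalP t u; elim=> {t u} //=.
- by move=> u t v _ -> _ ->.
- by move=> t t' u u' _ -> _ ->.
- by move=> t t' u u' _ -> _ ->.
- by move=> t u v; rewrite addrA.
- by move=> t u; rewrite addrC.
- by move=> t u v; rewrite mulrA.
- by move=> t u v; rewrite mulrDl.
- by move=> t u v; rewrite mulrDr.
- by move=> t; rewrite scale0r mul0r.
- by move=> t; rewrite scale1r mul1r.
- by move=> x y; rewrite scalerDl.
- by move=> x y; rewrite mulr_algl scalerA.
- by move=> x t; rewrite mulr_algl mulr_algr.
Qed.

Lemma yeval_sum (J : Type) (s : seq J) (G : J -> term) :
  yeval (\big[@YAdd F I/YC 0]_(p <- s) G p) = \sum_(p <- s) yeval (G p).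
Proof.
elim: s => [|p s IHs]; first by rewrite !big_nil /= scale0r.
by rewrite !big_cons /= IHs.
Qed.

End Eval.

(* All generators act by 0 on F. *)
Lemma ycong_neq10 : ~ ycong (YC 1) (YC 0).
Proof.
pose e := @yeval F^o (fun _ _ => 0) (fun _ _ _ => 0).
move=> c10; suff /eqP : e (YC 1) = e (YC 0).
  by rewrite /e /= scale0r scale1r oner_eq0.
apply: yeval_cong c10 => t u [] /= *;
  rewrite ?(mul0r, mulr0, scale0r, addr0, add0r) //.
  by case: ifP => //=; rewrite scale0r.
rewrite yeval_sum big1 // => p _.
by elim: (enum _) => [//|k l /= ->]; rewrite !mul0r mulr0 addr0.
Qed.

HB.instance Definition _ := gen_eqMixin term.
HB.instance Definition _ := gen_choiceMixin term.

Definition ycongb (t u : term) : bool := `[< ycong t u >].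

Lemma ycongb_equiv : equiv_class_of ycongb.
Proof.
split=> [t|t u|u t v].
- exact/asboolP/ycong_refl.
- by apply/asboolP/asboolP; exact: ycong_sym.
- by move=> /asboolP tu /asboolP uv; exact/asboolP/(ycong_trans tu).
Qed.

Canonical ycong_equiv := EquivRelPack ycongb_equiv.

Definition yangian := {eq_quot ycong_equiv}%qT.

HB.instance Definition _ := Choice.on yangian.
HB.instance Definition _ := EqQuotient.on yangian.

Definition ypi (t : term) : yangian := (\pi_yangian t)%qT.

Lemma ypiP t u : ypi t = ypi u <-> ycong t u.
Proof.
split; first by move=> /eqP; rewrite eqmodE => /asboolP.
by move=> tu; apply/eqP; rewrite eqmodE; exact/asboolP.
Qed.

Lemma ypiE (t : yangian) : t = ypi (repr t).
Proof. by rewrite /ypi reprK. Qed.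

Lemma repr_ypi t : ycong (repr (ypi t)) t.
Proof. by apply/ypiP; rewrite -ypiE. Qed.

Lemma yangian_ind (P : yangian -> Prop) : (forall t, P (ypi t)) -> forall y, P y.
Proof. by move=> Ppi y; rewrite (ypiE y). Qed.

Definition yadd (y z : yangian) := ypi (YAdd (repr y) (repr z)).
Definition ymul (y z : yangian) := ypi (YMul (repr y) (repr z)).
Definition yscale (c : F) (y : yangian) := ymul (ypi (YC c)) y.

Lemma yaddE t u : yadd (ypi t) (ypi u) = ypi (t + u)%Y.
Proof. by apply/ypiP; apply: ycong_add; exact: repr_ypi. Qed.

Lemma ymulE t u : ymul (ypi t) (ypi u) = ypi (t * u)%Y.
Proof. by apply/ypiP; apply: ycong_mul; exact: repr_ypi. Qed.

Lemma yaddA : associative yadd.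
Proof.
elim/yangian_ind=> t; elim/yangian_ind=> u; elim/yangian_ind=> v.
by rewrite !yaddE; apply/ypiP; exact: ycong_addA.
Qed.

Lemma yaddC : commutative yadd.
Proof.
elim/yangian_ind=> t; elim/yangian_ind=> u.
by rewrite !yaddE; apply/ypiP; exact: ycong_addC.
Qed.

Lemma ymulA : associative ymul.
Proof.
elim/yangian_ind=> t; elim/yangian_ind=> u; elim/yangian_ind=> v.
by rewrite !ymulE; apply/ypiP; exact: ycong_mulA.
Qed.

Lemma ymulDl : left_distributive ymul yadd.
Proof.
elim/yangian_ind=> t; elim/yangian_ind=> u; elim/yangian_ind=> v.
by rewrite !(ymulE, yaddE); apply/ypiP; exact: ycong_mulDl.
Qed.

Lemma ymulDr : right_distributive ymul yadd.
Proof.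
elim/yangian_ind=> t; elim/yangian_ind=> u; elim/yangian_ind=> v.
by rewrite !(ymulE, yaddE); apply/ypiP; exact: ycong_mulDr.
Qed.

Lemma ymul1 : left_id (ypi (YC 1)) ymul.
Proof. by elim/yangian_ind=> t; rewrite ymulE; apply/ypiP/ycong_1. Qed.

Lemma ymulC c y : ymul (ypi (YC c)) y = ymul y (ypi (YC c)).
Proof.
by elim/yangian_ind: y => t; rewrite !ymulE; apply/ypiP/ycong_cC.
Qed.

Lemma ymul1r : right_id (ypi (YC 1)) ymul.
Proof. by move=> y; rewrite -ymulC ymul1. Qed.

Lemma ymul0 y : ymul (ypi (YC 0)) y = ypi (YC 0).
Proof. by elim/yangian_ind: y => t; rewrite ymulE; apply/ypiP/ycong_0. Qed.

Lemma ycD x y : ypi (YC (x + y)) = yadd (ypi (YC x)) (ypi (YC y)).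
Proof. by rewrite yaddE; apply/ypiP/ycong_cD. Qed.

Lemma yadd0 : left_id (ypi (YC 0)) yadd.
Proof.
move=> y; rewrite -[in LHS](ymul1 y) -(ymul0 y) -ymulDl -ycD add0r.
by rewrite ymul1.
Qed.

Lemma yaddN : left_inverse (ypi (YC 0)) (yscale (-1)) yadd.
Proof.
move=> y; rewrite -[X in yadd _ X](ymul1 y) /yscale -ymulDl -ycD addNr.
by rewrite ymul0.
Qed.

HB.instance Definition _ := GRing.isZmodule.Build yangian
  yaddA yaddC yadd0 yaddN.

Lemma y1_neq0 : ypi (YC 1) != 0.
Proof. by apply/eqP => /ypiP; exact: ycong_neq10. Qed.

HB.instance Definition _ := GRing.Zmodule_isNzRing.Build yangian
  ymulA ymul1 ymul1r ymulDl ymulDr y1_neq0.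

Lemma yscaleA x y (z : yangian) : yscale x (yscale y z) = yscale (x * y) z.
Proof.
rewrite /yscale ymulA ymulE; congr ymul.
by apply/ypiP/ycong_sym/ycong_cM.
Qed.

Lemma yscaleDl (z : yangian) : {morph yscale^~ z : x y / x + y}.
Proof. by move=> x y; rewrite /yscale ycD ymulDl. Qed.

HB.instance Definition _ := GRing.Zmodule_isLmodule.Build F yangian
  yscaleA ymul1 (fun c => ymulDr (ypi (YC c))) yscaleDl.

Lemma yscaleAl (c : F) (y z : yangian) : c *: (y * z) = c *: y * z.
Proof. exact: ymulA. Qed.

HB.instance Definition _ := GRing.Lmodule_isLalgebra.Build F yangian yscaleAl.

Lemma yscaleAr (c : F) (y z : yangian) : c *: (y * z) = y * (c *: z).
Proof.
change (ymul (ypi (YC c)) (ymul y z) = ymul y (ymul (ypi (YC c)) z)).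
by rewrite !ymulA ymulC.
Qed.

HB.instance Definition _ := GRing.Lalgebra_isAlgebra.Build F yangian yscaleAr.

Definition y_xi i r : yangian := ypi (YXi i r).
Definition y_x b i r : yangian := ypi (YX b i r).

Lemma yevalK t : yeval y_xi y_x t = ypi t.
Proof.
elim: t => //= [c|t -> u ->|t -> u ->]; last 2 first.
- exact: yaddE.
- exact: ymulE.
- exact: ymul1r.
Qed.

Lemma yangian_rel t u : yrel t u -> yeval y_xi y_x t = yeval y_xi y_x u.
Proof. by move=> tu; rewrite !yevalK; apply/ypiP/ycong_rel. Qed.

Section Lift.
Variables (A : algType F) (fxi : I -> nat -> A) (fx : bool -> I -> nat -> A).
Hypothesis fP : forall t u, yrel t u -> yeval fxi fx t = yeval fxi fx u.

Definition ylift_def (y : yangian) : A := yeval fxi fx (repr y).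

Lemma ylift_pi t : ylift_def (ypi t) = yeval fxi fx t.
Proof. exact: yeval_cong (repr_ypi t). Qed.

Lemma ylift_lr : (monoid_morphism ylift_def * linear ylift_def)%type.
Proof.
split; first split.
- by rewrite [LHS]ylift_pi /= scale1r.
- elim/yangian_ind=> t; elim/yangian_ind=> u.
  by rewrite [ypi t * _]ymulE !ylift_pi.
- move=> c; elim/yangian_ind=> t; elim/yangian_ind=> u.
  rewrite [c *: _]ymulE [_ + _]yaddE !ylift_pi /=.
  by rewrite mulr_algl.
Qed.

Definition ylift
    & forall t u, yrel t u -> yeval fxi fx t = yeval fxi fx u :=
  ylift_def.

HB.instance Definition _ :=
  GRing.isLinear.Build F yangian A *:%R (ylift fP) ylift_lr.2.
HB.instance Definition _ :=
  GRing.isMonoidMorphism.Build yangian A (ylift fP) ylift_lr.1.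

End Lift.

End Yangian.

Arguments y_xi {F K hbar}.
Arguments y_x {F K hbar}.

Section Phi.
Variables (F : numClosedFieldType) (K : cartanData F) (hbar : F).
Variable i : cd_index K.
Hypotheses (di_neq0 : cd_d i != 0) (aii : cd_a i i = 2).

Local Notation di := (cd_d i).
Local Notation Y := (yangian K hbar).
Local Notation Ysl2 := (yangian (cartan_sl2 F) (di * hbar)).

Definition phi_xi (_ : cd_index (cartan_sl2 F)) r : Y := di^-1 *: y_xi i r.
Definition phi_x b (_ : cd_index (cartan_sl2 F)) r : Y :=
  (sqrtC di / di) *: y_x b i r.

Lemma phi_rel (t u : yterm F (cd_index (cartan_sl2 F))) :
  yrel (K := cartan_sl2 F) (di * hbar) t u ->
  yeval (K := cartan_sl2 F) phi_xi phi_x t =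
  yeval (K := cartan_sl2 F) phi_xi phi_x u.
Proof.
have rel := @yangian_rel F K hbar.
have d2 : di * 2 / 2 = di by rewrite mulfK // pnatr_eq0.
have brZ (x y : F) (p q : Y) :
    (x *: p) * (y *: q) + (-1)%:A * ((y *: q) * (x *: p)) =
    (x * y) *: (p * q + (-1)%:A * (q * p)).
  rewrite !mulr_algl -!scalerAl -!scalerAr !scalerA scalerDr !scalerA.
  by rewrite mulrN1 mulN1r mulNr [y * x]mulrC.
have brB (x : F) (p q : Y) :
    x *: p + (-1)%:A * (x *: q) = x *: (p + (-1)%:A * q).
  by rewrite -scalerAr -scalerDr.
have acZ (x y z : F) (p q : Y) :
    z%:A * ((x *: p) * (y *: q) + (y *: q) * (x *: p)) =
    (x * y) *: (z%:A * (p * q + q * p)).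
  rewrite !mulr_algl -!scalerAl -!scalerAr !scalerA [y * x]mulrC -scalerDr.
  by rewrite !scalerA mulrC.
have cc : (sqrtC di / di) * (sqrtC di / di) = di^-1.
  by rewrite mulrACA -expr2 sqrtCK mulrA divff // mul1r.
rewrite /phi_xi /phi_x; move: (sqrtC di / di) cc => c cc.
case.
- move=> [] [] r s; have := rel _ _ (yrel_xixi hbar i i r s); rewrite /= brZ => ->.
  by rewrite scale0r scaler0.
- move=> b [] [] s; have := rel _ _ (yrel_xi0x hbar b i i s); rewrite /= brZ => ->.
  rewrite !mulr_algl !scalerA aii mul1r; congr (_ *: _).
  by field.
- move=> b [] [] r s; have := rel _ _ (yrel_xix hbar b i i r s).
  rewrite /= !brZ brB acZ => ->.
  rewrite aii d2 !mulr_algl !scalerA; congr (_ *: _).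
  by field; rewrite ?pnatr_eq0.
- move=> b [] [] r s; have := rel _ _ (yrel_xx hbar b i i r s).
  rewrite /= !brZ brB acZ => ->.
  rewrite aii d2 !mulr_algl !scalerA; congr (_ *: _).
  by field; rewrite ?pnatr_eq0.
- move=> [] [] r s; have := rel _ _ (yrel_xpxm hbar i i r s).
  by rewrite /= brZ !eqxx /= cc => ->.
- by move=> b [] [] m rr s; rewrite eqxx.
Qed.

Definition phi : {lrmorphism Ysl2 -> Y} := ylift phi_rel.

Lemma phiE_xi r : phi (y_xi (K := cartan_sl2 F) tt r) = di^-1 *: y_xi i r.
Proof. exact: (ylift_pi phi_rel). Qed.

Lemma phiE_x b r : phi (y_x (K := cartan_sl2 F) b tt r) = (sqrtC di / di) *: y_x b i r.
Proof. exact: (ylift_pi phi_rel). Qed.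

(* The coefficients of phi(xi(u)) = xi_i(u) and phi(x(u)) = sqrt(d_i) x_i(u),
   where the generating series of the Yangian of sl_2 carry the parameter
   d_i hbar. *)
Lemma phi_xi_series r : (di * hbar) *: phi (y_xi (K := cartan_sl2 F) tt r) = hbar *: y_xi i r.
Proof. by rewrite phiE_xi scalerA mulrAC divff // mul1r. Qed.

Lemma phi_x_series b r :
  (di * hbar) *: phi (y_x (K := cartan_sl2 F) b tt r) = sqrtC di *: (hbar *: y_x b i r).
Proof. by rewrite phiE_x !scalerA mulrC mulrA divfK. Qed.

End Phi.

Section SimpleCartan.
Variables (F : numClosedFieldType) (g : simpleLie F).

Lemma root_form_neq0 (i : sl_index g) :
  dual_form (@sl_form F g) (sl_root i) (sl_root i) != 0.
Proof.
have [rooti _ _] := sl_rootP g.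
by rewrite gt_eqF // (lt_le_trans _ (sl_short_ge2 (rooti i))) // ltr0n.
Qed.

Lemma cartan_d_neq0 (i : cd_index (cartan_of g)) : cd_d i != 0.
Proof. by rewrite mulf_neq0 ?invr_neq0 ?pnatr_eq0 ?root_form_neq0. Qed.

Lemma cartan_aii (i : cd_index (cartan_of g)) : cd_a i i = 2.
Proof. by rewrite /= mulfK ?root_form_neq0. Qed.

Definition yangian_phi (hbar : F) (i : cd_index (cartan_of g)) :=
  phi hbar (cartan_d_neq0 i) (cartan_aii i).

End SimpleCartan.

Record representation (F : fieldType) (A : algType F) (V : vectType F) :=
  Representation {
    rep_act :> {linear A -> 'End(V)};
    rep_1 : rep_act 1 = \1%VF;
    rep_M : forall x y, rep_act (x * y) = (rep_act x \o rep_act y)%VF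
  }.

Section Pullback.
Variables (F : fieldType) (A B : algType F) (V : vectType F).
Variables (f : {lrmorphism A -> B}) (rho : representation B V).

Let act : {linear A -> 'End(V)} := rho \o f.

Let act1 : act 1 = \1%VF.
Proof. by rewrite /act /= rmorph1 rep_1. Qed.

Let actM x y : act (x * y) = (act x \o act y)%VF.
Proof. by rewrite /act /= rmorphM rep_M. Qed.

Definition pullback : representation A V := Representation act1 actM.

End Pullback.

Section Poles.
Variables (F : fieldType) (W : lmodType F).

(* A series in u^-1 with coefficients in [W] is the function giving the
   coefficient of u^-n; [gen_series c h w] is
   c + h \sum_(r >= 0) w_r u^(-r-1). *)
Definition gen_series (c : W) (h : F) (w : nat -> W) : nat -> W :=
  fun n => if n is r.+1 then h *: w r else c.

(* [f] is the expansion at u = oo of the W-valued rational function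
   P(u) / q(u), that is q(u) f(u) = P(u) as Laurent series in u^-1; the two
   conditions compare the coefficients of u^j and of u^(-j-1). *)
Definition expansion (f : nat -> W) (P : seq W) (q : {poly F}) :=
  forall j,
    \sum_(k < size q | (j <= k)%N) q`_k *: f (k - j)%N = P`_j /\
    \sum_(k < size q) q`_k *: f (k + j.+1)%N = 0.

Definition regular_at (f : nat -> W) (z : F) :=
  exists (P : seq W) (q : {poly F}), expansion f P q /\ q.[z] != 0.

(* For the expansion of a rational function these are its poles; if [f] is not
   such an expansion, no point is regular. *)
Definition poles (f : nat -> W) : set F := [set z | ~ regular_at f z]%classic.

End Poles.

Section GenEigenspace.
Variables (F : fieldType) (V : vectType F).

Lemma vspace_of_closed (P : V -> Prop) :
  P 0 -> (forall c u v, P u -> P v -> P (c *: u + v)) ->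
  exists U : {vspace V}, forall v, v \in U <-> P v.
Proof.
move=> P0 PD.
pose sub (U : {vspace V}) := forall v, v \in U -> P v.
pose hasdim n := `[< exists2 U : {vspace V}, sub U & \dim U = n >].
have hasd0 : exists n, hasdim n.
  exists 0%N; apply/asboolP; exists 0%VS; last exact: dimv0.
  by move=> v; rewrite memv0 => /eqP ->.
have hasd_le n : hasdim n -> (n <= \dim {:V})%N.
  by move=> /asboolP[U _ <-]; rewrite dimvS ?subvf.
case: (ex_maxnP hasd0 hasd_le) => n /asboolP[U subU dimU] maxn.
exists U => v; split=> [|Pv]; first exact: subU.
have subUv : sub (U + <[v]>)%VS.
  move=> w /memv_addP[u uU [x /vlineP[c ->] ->]].
  by rewrite addrC; apply: PD => //; exact: subU.
have /maxn : hasdim (\dim (U + <[v]>)) by apply/asboolP; exists (U + <[v]>)%VS.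
rewrite -dimU => dimUv.
have /eqP -> : U == (U + <[v]>)%VS by rewrite eqEdim addvSl dimUv.
by rewrite (subvP (addvSr _ _)) ?memv_line.
Qed.

Variables (J : Type) (A : J -> 'End(V)) (c : J -> F).

Definition in_gen_eigen (v : V) := forall j, exists N,
  (0 < N)%N /\ iter N (A j - c j *: \1)%VF v = 0.

Lemma gen_eigen_exists :
  exists U : {vspace V}, forall v, v \in U <-> in_gen_eigen v.
Proof.
have iter_lin (f : 'End(V)) n (x : F) u v :
    iter n f (x *: u + v) = x *: iter n f u + iter n f v.
  by elim: n => //= n ->; rewrite linearP.
have iter0 (f : 'End(V)) n : iter n f 0 = 0.
  by elim: n => //= n ->; rewrite linear0.
apply: vspace_of_closed => [j|x u v Pu Pv j].
  by exists 1%N; split=> //=; rewrite linear0.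
have [m [m0 um]] := Pu j; have [n [n0 vn]] := Pv j.
exists (m + n)%N; split; first by rewrite addn_gt0 m0.
by rewrite iter_lin {1}addnC !iterD um vn !iter0 scaler0 addr0.
Qed.

Definition gen_eigen : {vspace V} := projT1 (cid gen_eigen_exists).

Lemma gen_eigenP v : v \in gen_eigen <-> in_gen_eigen v.
Proof. exact: (projT2 (cid gen_eigen_exists)). Qed.

End GenEigenspace.

Section QCharacter.
Variables (F : numClosedFieldType) (K : cartanData F) (hbar : F).
Local Notation I := (cd_index K).

(* A tuple (mu_i(u)) is given by the coefficients mu_{i,r} of
   mu_i(u) = 1 + hbar \sum_r mu_{i,r} u^(-r-1); this is one-to-one when
   hbar != 0. *)
Definition ell_weight := I -> nat -> F.

Section Module.
Variables (V : vectType F) (rho : representation (yangian K hbar) V).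

Definition sigma_mod (i : I) : set F :=
  (poles (gen_series (\1%VF : 'End(V)) hbar (fun r => rho (y_xi i r)))
   `|` poles (gen_series 0 hbar (fun r => rho (y_x true i r)))
   `|` poles (gen_series 0 hbar (fun r => rho (y_x false i r))))%classic.

Definition weight_space (mu : ell_weight) : {vspace V} :=
  gen_eigen (fun ik : I * nat => rho (y_xi ik.1 ik.2))
            (fun ik => mu ik.1 ik.2).

(* The element \sum_mu dim V[mu] e(mu) of the group ring is given by its
   coefficient function. *)
Definition qchar (mu : ell_weight) : int := (\dim (weight_space mu))%:Z.

End Module.

Definition sigma_char (chi : ell_weight -> int) (i : I) : set F :=
  (\bigcup_(mu in [set mu | chi mu <> 0])
     poles (gen_series (1 : F^o) hbar (mu i)))%classic.

End QCharacter.

(* Main.v *)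
Require Import Defs.
From HB Require Import structures.
From mathcomp Require Import all_boot all_order all_algebra.
From mathcomp Require Import boolp classical_sets reals complex.
From mathcomp Require Import ring lra.
Local Open Scope ring_scope.

(* The rank-one currents x^+(u), x^-(u), xi(u) are handled through the linear
   maps p |-> X^b[p] = sum_k p_k x^b_k and p |-> Xi[p] on polynomials: a current
   is regular at z as soon as some q with q(z) <> 0 satisfies X^b[q r] = 0 for
   all r. Since x^b_k = (+-ad T)^k x^b_0 for T = (xi_1 - (kap/e) xi_0^2) / e, a
   nonzero polynomial m annihilates both currents, and the maps X^b split into
   components at the roots of m (the principal parts at the poles). Components
   of x^+ and x^- at distinct points commute, and a component at d can be moved
   past one of the same sign at c unless d - c = +-kap.

   Suppose that no eigenvalue of xi(u) has a pole at z, so that the component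
   of xi at z is nilpotent. If V is irreducible, put H = {c | ell c > ell a},
   with ell additive, ell kap = 1 and a between z and z + kap. Call the
   components of x^+ outside H and of x^- inside H "lowering" and the other
   ones "raising", according to their effect on ell of the eigenvalues of
   theta = T - (a/e) xi_0. A joint eigenvector u of minimal theta-eigenvalue is killed
   by the lowering components and generates V under the raising ones, and these
   roles make u a highest weight vector for an unusual choice of positive part.
   If F is the component of x^- at z, the lowering components kill F u as well
   (xi has a zero component at z on u), so F u generates a proper submodule and
   vanishes. Moving the components at z to the right through the raising ones
   shows that they vanish on V.

   For an extension of V/U by U, the components at z kill U and map V to U, so
   the component of xi at z vanishes, and those of x^+ and x^- are extremal
   vectors of the wrong weight in the finite-dimensional sl_2-module End(V). *)

Set Implicit Arguments.
Unset Strict Implicit.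
Unset Printing Implicit Defensive.
Import Order.TTheory GRing.Theory Num.Theory.

(** * Linear extension of sequences to polynomials *)

Section PolyEval.
Variables (F : fieldType) (W : lmodType F).
Implicit Types (f : nat -> W) (p q : {poly F}).

(** This is the coefficient of u^-1 in p(u) times the series of the f_k u^(-k-1), so multiplying the
    series by a polynomial becomes multiplying the argument. *)
Definition ev f p : W := \sum_(k < size p) p`_k *: f k.

Lemma ev_widen f p n : (size p <= n)%N -> ev f p = \sum_(k < n) p`_k *: f k.
Proof.
move=> le_pn; rewrite /ev (big_ord_widen n (fun k => p`_k *: f k)) //.
rewrite big_mkcond; apply: eq_bigr => k _; case: ltnP => // le_pk.
by rewrite nth_default // scale0r.
Qed.

Lemma ev_is_linear f : linear (ev f).
Proof.
move=> c p q; pose n := maxn (size p) (size q).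
have le_pn : (size p <= n)%N by rewrite leq_maxl.
have le_qn : (size q <= n)%N by rewrite leq_maxr.
have le_n : (size (c *: p + q)%R <= n)%N.
  rewrite (leq_trans (size_polyD _ _)) // geq_max le_qn andbT.
  by rewrite (leq_trans (size_scale_leq _ _)).
rewrite !(@ev_widen f _ n) // scaler_sumr -big_split /=.
by apply: eq_bigr => k _; rewrite coefD coefZ scalerDl scalerA.
Qed.

HB.instance Definition _ f :=
  GRing.isLinear.Build F {poly F} W *:%R (ev f) (ev_is_linear f).

Lemma evXn f k : ev f 'X^k = f k.
Proof.
rewrite (@ev_widen f _ k.+1) ?size_polyXn // big_ord_recr /= coefXn eqxx.
rewrite scale1r big1 ?add0r // => i _.
by rewrite coefXn (ltn_eqF (ltn_ord i)) scale0r.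
Qed.

Lemma ev1 f : ev f 1 = f 0.
Proof. by rewrite -(evXn f 0) expr0. Qed.

(** Linearity is kept unbundled, so that identities in several polynomials reduce to monomials one
    variable at a time. *)
Lemma linear_poly0 (L : {poly F} -> W) :
  (forall c p q, L (c *: p + q) = c *: L p + L q) ->
  (forall k, L 'X^k = 0) -> forall p, L p = 0.
Proof.
move=> Llin LX p.
have L0 : L 0 = 0 by have := LX 0%N; have := Llin (-1) 1 1;
  rewrite scaleN1r addNr expr0 => -> ->; rewrite scaler0 addr0.
rewrite -(coefK p) poly_def; elim/big_ind: _ => // [q r Lq Lr|i _].
  by have := Llin 1 q r; rewrite !scale1r Lq Lr addr0.
by have := Llin p`_i 'X^i 0; rewrite addr0 LX scaler0 L0 addr0.
Qed.

Lemma evMX f p : ev f (p * 'X) = ev (f \o S) p.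
Proof.
apply/eqP; rewrite -subr_eq0; apply/eqP; move: p.
apply: linear_poly0 => [c p q|k]; last by rewrite -exprSr !evXn /= subrr.
by rewrite mulrDl -scalerAl !linearP /= addrACA -scalerDr.
Qed.

End PolyEval.

(** * Coordinates for checking vector identities *)

Section Coordinates.
Import VectorInternalTheory.
Variable F : fieldType.
Implicit Types V W : vectType F.

Definition crd V (i : 'I_(dim V)) (v : V) : F := v2r v 0 i.

Lemma crd_inj V (u v : V) : (forall i, crd i u = crd i v) -> u = v.
Proof. by move=> eq_uv; apply: (can_inj v2rK); apply/rowP. Qed.

Lemma crdD V (i : 'I_(dim V)) u v : crd i (u + v) = crd i u + crd i v.
Proof. by rewrite /crd linearD mxE. Qed.

Lemma crdN V (i : 'I_(dim V)) v : crd i (- v) = - crd i v.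
Proof. by rewrite /crd linearN mxE. Qed.

Lemma crdZ V (i : 'I_(dim V)) c v : crd i (c *: v) = c * crd i v.
Proof. by rewrite /crd linearZ mxE. Qed.

Lemma crd0 V (i : 'I_(dim V)) : crd i (0 : V) = 0.
Proof. by rewrite /crd linear0 mxE. Qed.

Lemma lfunD V W (f : 'Hom(V, W)) u v : f (u + v) = f u + f v.
Proof. exact: linearD. Qed.

Lemma lfunN V W (f : 'Hom(V, W)) v : f (- v) = - f v.
Proof. exact: linearN. Qed.

Lemma lfunZ V W (f : 'Hom(V, W)) c v : f (c *: v) = c *: f v.
Proof. exact: linearZ. Qed.

Lemma lfun_at0 V W (f : 'Hom(V, W)) : f 0 = 0.
Proof. exact: linear0. Qed.

End Coordinates.

Ltac lfun_expand := rewrite ?(add_lfunE, opp_lfunE, scale_lfunE, zero_lfunE,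
  comp_lfunE, id_lfunE, lfunD, lfunN, lfunZ, lfun_at0).

(* Equalities in a finite-dimensional space are checked coordinatewise. *)
Ltac crd_expand := lfun_expand; apply: crd_inj => ?;
  rewrite ?(crdD, crdN, crdZ, crd0).

Ltac vring := crd_expand; ring.

(** * Eigenvectors and nilpotency *)

Section LinearAlgebra.
Variables (F : closedFieldType) (V : vectType F).
Implicit Types (T : 'End(V)) (v : V) (P : V -> Prop).

Lemma ev_dependent (W : vectType F) (f : nat -> W) :
  exists2 p : {poly F}, p != 0 & ev f p = 0.
Proof.
pose n := \dim {: W}.
pose X := [tuple f i | i < n.+1].
have nfree : ~~ free X.
  apply/negP => freeX; have := dimvS (subvf <<X>>%VS).
  by rewrite (eqP freeX) size_tuple ltnn.
case: (pselect (forall k : 'I_n.+1 -> F,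
    \sum_(i < n.+1) k i *: X`_i = 0 -> forall i, k i = 0)) => [freeX|].
  by case/freeP: nfree.
move=> /existsNP[k /not_implyP[sum0 /existsNP[i /eqP ki]]].
exists (\poly_(j < n.+1) k (inord j)).
  apply: contra_neq ki => p0; have /(congr1 (fun p : {poly F} => p`_i)) := p0.
  by rewrite coef_poly ltn_ord coef0 inord_val.
rewrite (@ev_widen _ _ f _ n.+1) ?size_poly // -[RHS]sum0.
apply: eq_bigr => j _; rewrite coef_poly ltn_ord inord_val.
by rewrite -tnth_nth tnth_mktuple.
Qed.

Lemma iter_lin T k c u v :
  iter k T (c *: u + v) = c *: iter k T u + iter k T v.
Proof. by elim: k => //= k ->; rewrite linearP. Qed.

Lemma ev_iterMX T v (p : {poly F}) :
  ev (fun k => iter k T v) (p * 'X) = ev (fun k => iter k T (T v)) p.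
Proof. by rewrite evMX; apply: eq_bigr => k _; rewrite -iterSr. Qed.

Definition lin_closed P := forall c u v, P u -> P v -> P (c *: u + v).

Definition stable T P := forall v, P v -> P (T v).

Lemma lin_closed0 P v : lin_closed P -> P v -> P 0.
Proof. by move=> Plin Pv; rewrite -(addNr v) -scaleN1r; exact: Plin. Qed.

Lemma lin_closedD P u v : lin_closed P -> P u -> P v -> P (u + v).
Proof. by move=> Plin Pu Pv; rewrite -(scale1r u); exact: Plin. Qed.

Lemma lin_closedZ P c v : lin_closed P -> P v -> P (c *: v).
Proof.
by move=> Plin Pv; rewrite -(addr0 (c *: v)); apply: Plin (lin_closed0 Plin Pv).
Qed.

Lemma lin_closedB P u v : lin_closed P -> P u -> P v -> P (u - v).
Proof. by move=> Plin Pu Pv; rewrite addrC -scaleN1r; exact: Plin. Qed.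

(** The linear factors of [p] are applied to [v] one after another; the last nonzero vector obtained
    is an eigenvector, and it stays in [P]. *)
Lemma eigenvector_root T P v (p : {poly F}) :
    stable T P -> lin_closed P -> P v -> v != 0 -> p != 0 ->
    ev (fun k => iter k T v) p = 0 ->
  exists lam w, [/\ root p lam, P w, w != 0 & T w = lam *: w].
Proof.
move=> PT Plin Pv v0 p0.
have [s ->] := closed_field_poly_normal p.
rewrite linearZ => /eqP; rewrite scaler_eq0 lead_coef_eq0 (negPf p0) /= => /eqP.
suff: ev (fun k => iter k T v) (\prod_(z <- s) ('X - z%:P)) = 0 ->
    exists lam w, [/\ lam \in s, P w, w != 0 & T w = lam *: w].
  move=> H /H[lam [w [lams Pw w0 Tw]]]; exists lam, w; split=> //.
  by rewrite rootZ ?lead_coef_eq0 // root_prod_XsubC.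
elim: s v Pv v0 => [|r s IHs] v Pv v0.
  by rewrite big_nil ev1 /= => v00; rewrite v00 eqxx in v0.
rewrite big_cons mulrC mulrBr linearB /= evMX mulrC mul_polyC linearZ /=.
have [Tv _|Tv] := eqVneq (T v) (r *: v).
  by exists r, v; rewrite mem_head.
move=> evs; have [|||lam [w [lams Pw w0 Tw]]] := IHs (T v - r *: v).
- by apply: lin_closedB => //; [exact: PT|exact: lin_closedZ].
- by rewrite subr_eq0.
- rewrite -evs /ev scaler_sumr -sumrB; apply: eq_bigr => k _.
  rewrite scalerA mulrC -scalerA -scalerBr; congr (_ *: _).
  have -> : T v - r *: v = - r *: v + T v by rewrite scaleNr addrC.
  by rewrite iter_lin scaleNr addrC /= -iterSr.
- by exists lam, w; rewrite inE lams orbT.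
Qed.

Lemma eigenvector_exists T P v :
    stable T P -> lin_closed P -> P v -> v != 0 ->
  exists lam w, [/\ P w, w != 0 & T w = lam *: w].
Proof.
move=> PT Plin Pv v0; have [p p0 evp] := ev_dependent (fun k => iter k T v).
by have [lam [w []]] := eigenvector_root PT Plin Pv v0 p0 evp; exists lam, w.
Qed.

(** Induction on the dimension of [P]: if some [A j] is not scalar on [P], one of its eigenspaces in
    [P] is smaller and stable under the whole commuting family, which may be infinite. *)
Lemma joint_eigenvector (J : Type) (A : J -> 'End(V)) P v :
    (forall i j w, A i (A j w) = A j (A i w)) ->
    (forall j, stable (A j) P) -> lin_closed P -> P v -> v != 0 ->
  exists (c : J -> F) (w : V), [/\ P w, w != 0 & forall j, A j w = c j *: w].
Proof.
move=> comm PA Plin Pv v0.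
have [U UP] := vspace_of_closed (lin_closed0 Plin Pv) Plin.
have [n] := ubnP (\dim U); elim: n => // n IHn in P v PA Plin Pv v0 U UP *.
rewrite ltnS => dimU.
have [/choice|] :=
    pselect (forall j, exists c, forall w, P w -> A j w = c *: w).
  by case=> c cP; exists c, v; split=> // j; exact: cP.
move=> /existsNP[j nscal].
have [lam [w [Pw w0 Aw]]] := eigenvector_exists (PA j) Plin Pv v0.
pose P' z := P z /\ A j z = lam *: z.
have P'lin : lin_closed P'.
  move=> c y z [Py Ay] [Pz Az]; split; first exact: Plin.
  by rewrite linearP /= Ay Az scalerDr !scalerA mulrC.
have P'w : P' w by [].
have [U' U'P] := vspace_of_closed (lin_closed0 P'lin P'w) P'lin.
have [||c [z [[Pz _] z0 Az]]] := IHn P' w _ P'lin P'w w0 U' U'P.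
- by move=> i z [Pz Az]; split; [exact: PA | rewrite comm Az linearZ].
- apply: leq_trans dimU.
  have sU : (U' <= U)%VS by apply/subvP => z /U'P[/UP].
  rewrite (ltn_leqif (dimv_leqif_sup sU)); apply/negP => /subvP UU'.
  by apply: nscal; exists lam => z /UP/UU'/U'P[].
- by exists c, z.
Qed.

(** Write a polynomial killing [v] as X^k q with q(0) nonzero. If T^k v were nonzero, q would kill
    it and some root of q would be an eigenvalue. *)
Lemma nilpotent_of_eigenvalues T :
  (forall lam w, w != 0 -> T w = lam *: w -> lam = 0) ->
  forall v, exists k, iter k T v = 0.
Proof.
move=> eig0 v; have [p p0 evp] := ev_dependent (fun k => iter k T v).
have [k [q q0 pE]] := multiplicity_XsubC p 0; rewrite p0 /= subr0 in q0 pE.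
exists k; apply/eqP; apply: contraT => w0.
have qn0 : q != 0 by apply: contraNneq p0 => q00; rewrite pE q00 mul0r.
have evq : ev (fun m => iter m T (iter k T v)) q = 0.
  rewrite -evp pE; elim: (k) (v) => [|m IHm] v' /=; first by rewrite mulr1.
  by rewrite exprSr mulrA ev_iterMX -IHm -iterSr.
have [//|//|lam [w [qlam _ wn0 Tw]]] :=
  @eigenvector_root T (fun=> True) _ q _ _ I w0 qn0 evq.
by rewrite (eig0 _ _ wn0 Tw) (negPf q0) in qlam.
Qed.

End LinearAlgebra.

(* The relations among the xi_{i,r} and x_{i,r} for a single i; in the Yangian
   of g, [e = 2 d_i] and [kap = d_i hbar]. *)
Record rank_one (F : numClosedFieldType) (e kap : F) (V : vectType F)
    (xi : nat -> 'End(V)) (x : bool -> nat -> 'End(V)) : Prop := RankOne {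
  r1_xixi : forall r s v, xi r (xi s v) = xi s (xi r v);
  r1_xi0x : forall b s v,
    xi 0%N (x b s v) - x b s (xi 0%N v) = (pm b * e) *: x b s v;
  r1_xix : forall b r s v,
    (xi r.+1 (x b s v) - x b s (xi r.+1 v))
      - (xi r (x b s.+1 v) - x b s.+1 (xi r v)) =
    (pm b * kap) *: (xi r (x b s v) + x b s (xi r v));
  r1_xx : forall b r s v,
    (x b r.+1 (x b s v) - x b s (x b r.+1 v))
      - (x b r (x b s.+1 v) - x b s.+1 (x b r v)) =
    (pm b * kap) *: (x b r (x b s v) + x b s (x b r v));
  r1_xpxm : forall r s v,
    x true r (x false s v) - x false s (x true r v) = xi (r + s)%N v
}.

Lemma pm_sqr (F : pzRingType) b : pm b * pm b = 1 :> F.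
Proof. by case: b; rewrite /pm ?mulr1 // mulrNN mulr1. Qed.

(** * Relations between the currents in polynomial form *)

Section RankOneTheory.
Variables (F : numClosedFieldType) (e kap : F).
Hypothesis e_neq0 : e != 0.
Variables (V : vectType F) (xi : nat -> 'End(V)) (x : bool -> nat -> 'End(V)).
Hypothesis sys : rank_one e kap xi x.

Local Notation X b p := (ev (x b) p).
Local Notation Xi p := (ev xi p).

Let XXn b k : X b 'X^k = x b k. Proof. exact: evXn. Qed.
Let XiXn k : Xi 'X^k = xi k. Proof. exact: evXn. Qed.
Let X_lin b c p q : X b (c *: p + q) = c *: X b p + X b q.
Proof. exact: linearP. Qed.
Let Xi_lin c p q : Xi (c *: p + q) = c *: Xi p + Xi q.
Proof. exact: linearP. Qed.

Lemma polyMlin (c : F) (p q r : {poly F}) :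
  (c *: p + q) * r = c *: (p * r) + q * r.
Proof. by rewrite mulrDl scalerAl. Qed.

Lemma polyMlinr (c : F) (p q r : {poly F}) :
  r * (c *: p + q) = c *: (r * p) + r * q.
Proof. by rewrite mulrDr scalerAr. Qed.

Lemma xpxm_poly p q v :
  X true p (X false q v) - X false q (X true p v) = Xi (p * q) v.
Proof.
apply/eqP; rewrite -subr_eq0; apply/eqP; move: p.
apply: linear_poly0 => [c p p'|r].
  by rewrite polyMlin !X_lin !Xi_lin; vring.
move: q; apply: linear_poly0 => [c p p'|s].
  by rewrite polyMlinr !X_lin !Xi_lin; vring.
by rewrite -exprD !XXn XiXn (r1_xpxm sys) subrr.
Qed.

Lemma x_opp_comm b p q v :
  X b p (X (~~ b) q v) = X (~~ b) q (X b p v) + pm b *: Xi (p * q) v.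
Proof.
case: b => /=; rewrite /pm ?scale1r ?scaleN1r.
  by rewrite -xpxm_poly addrC subrK.
by rewrite mulrC -xpxm_poly opprB addrC subrK.
Qed.

Lemma xi0x_poly b p v :
  xi 0%N (X b p v) = X b p (xi 0%N v) + (pm b * e) *: X b p v.
Proof.
apply/eqP; rewrite -subr_eq0; apply/eqP; move: p.
apply: linear_poly0 => [c p p'|r]; first by rewrite !X_lin; vring.
by rewrite !XXn opprD addrA (r1_xi0x sys) subrr.
Qed.

Lemma xix_poly b r p v :
  X b p (xi r.+1 v) = xi r.+1 (X b p v) - xi r (X b (p * 'X) v)
    + X b (p * 'X) (xi r v) - (pm b * kap) *: (xi r (X b p v) + X b p (xi r v)).
Proof.
apply/eqP; rewrite -subr_eq0; apply/eqP; move: p.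
apply: linear_poly0 => [c p p'|s]; first by rewrite polyMlin !X_lin; vring.
by rewrite -exprSr !XXn -(r1_xix sys); vring.
Qed.

Lemma xx_poly b p q v :
  X b (p * 'X) (X b q v) - X b p (X b (q * 'X) v)
    - (pm b * kap) *: X b p (X b q v) =
  X b q (X b (p * 'X) v) - X b (q * 'X) (X b p v)
    + (pm b * kap) *: X b q (X b p v).
Proof.
apply/eqP; rewrite -subr_eq0; apply/eqP; move: p.
apply: linear_poly0 => [c p p'|r]; first by rewrite polyMlin !X_lin; vring.
move: q; apply: linear_poly0 => [c p p'|s].
  by rewrite polyMlin !X_lin; vring.
rewrite -!exprSr !XXn.
have /eqP := r1_xx sys b r s v; rewrite -subr_eq0 => /eqP H.
by rewrite -[RHS]H; vring.
Qed.

Definition theta (a : F) : 'End(V) :=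
  e^-1 *: (xi 1%N - (kap / e) *: (xi 0%N \o xi 0%N)%VF) - (a / e) *: xi 0%N.

(** The anticommutator of xi_0 and x in the relation for xi_1 is cancelled by the term in xi_0^2;
    multiplication by ['X] is left, and the term in xi_0 recenters it at [a]. *)
Lemma theta_x a b p v :
  theta a (X b p v) = X b p (theta a v) + pm b *: X b (p * ('X - a%:P)) v.
Proof.
have -> : X b (p * ('X - a%:P)) = X b (p * 'X) - a *: X b p.
  by rewrite mulrBr [p * a%:P]mulrC mul_polyC linearB linearZ.
have h1 : xi 1%N (X b p v) = X b p (xi 1%N v) + xi 0%N (X b (p * 'X) v)
    - X b (p * 'X) (xi 0%N v)
    + (pm b * kap) *: (xi 0%N (X b p v) + X b p (xi 0%N v)).
  by rewrite (xix_poly b 0 p v); vring.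
rewrite /theta !(add_lfunE, opp_lfunE, scale_lfunE, comp_lfunE) h1 !xi0x_poly.
rewrite !linearD !linearZ /= !xi0x_poly.
by crd_expand; field.
Qed.

End RankOneTheory.

(** Bezout. It serves to remove from an argument a factor that does not vanish at the point
    considered. *)
Lemma coprime_ideal (F : fieldType) (J : {poly F} -> Prop) (p f g : {poly F}) :
    (forall q r, J q -> J r -> J (q + r)) -> (forall q r, J q -> J (q * r)) ->
  coprimep f g -> J (p * f) -> J (p * g) -> J p.
Proof.
move=> JD JM /Bezout_eq1_coprimepP[[u v] /= uv1] Jf Jg.
rewrite -[p]mulr1 -uv1 mulrDr.
by apply: JD; rewrite mulrCA mulrC; exact: JM.
Qed.

Lemma lin_closed_ev (F : closedFieldType) (V : vectType F) (P : V -> Prop)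
    (f : nat -> 'End(V)) p v :
  lin_closed P -> P v -> (forall k, P (f k v)) -> P (ev f p v).
Proof.
move=> Plin Pv Pf; rewrite /ev sum_lfunE; elim/big_ind: _ => [|y z Py Pz|i _].
- exact: lin_closed0 Pv.
- exact: lin_closedD.
- by rewrite scale_lfunE; exact: lin_closedZ.
Qed.

(** * Components of the currents at their poles *)

Section RankOneLocal.
Variables (F : numClosedFieldType) (e kap : F).
Hypothesis e_neq0 : e != 0.
Variables (V : vectType F) (xi : nat -> 'End(V)) (x : bool -> nat -> 'End(V)).
Hypothesis sys : rank_one e kap xi x.

Local Notation X b p := (ev (x b) p).
Local Notation Xi p := (ev xi p).

(** Quantifying over [q] makes these polynomials an ideal: the common denominators of x^+(u) and
    x^-(u). *)
Definition annih (p : {poly F}) := forall b q, X b (p * q) = 0.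

(** Equivalently, p(u) x^+(u) and p(u) x^-(u) have no pole outside [c], so [X b p] only sees the
    principal part at [c]. *)
Definition loc c p := exists n, annih (p * ('X - c%:P) ^+ n).

Lemma annih_eq0 p b : annih p -> X b p = 0.
Proof. by move=> /(_ b 1); rewrite mulr1. Qed.

Lemma annihD p q : annih p -> annih q -> annih (p + q).
Proof. by move=> pA qA b r; rewrite mulrDl linearD /= pA qA addr0. Qed.

Lemma annihM p q : annih p -> annih (p * q).
Proof. by move=> pA b r; rewrite -mulrA pA. Qed.

(** [Xi p] is the commutator of [X true p] and [X false 1]. *)
Lemma annih_Xi p : annih p -> Xi p = 0.
Proof.
move=> pA; apply/lfunP => v; rewrite -[p]mulr1 -(xpxm_poly sys).
by rewrite (annih_eq0 true pA) !zero_lfunE linear0 subrr.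
Qed.

Lemma locM c p q : loc c p -> loc c (p * q).
Proof. by case=> n nA; exists n; rewrite mulrAC; exact: annihM. Qed.

Lemma loc_annih c p g : loc c p -> ~~ root g c -> annih (p * g) -> annih p.
Proof.
move=> [n pnA] gc pgA; apply: coprime_ideal pgA pnA.
- exact: annihD.
- exact: annihM.
- by rewrite coprimep_expr // coprimep_XsubC.
Qed.

Lemma loc_disjoint c d p q : c != d -> loc c p -> loc d q -> annih (p * q).
Proof.
move=> neq_cd pc [n qA]; apply: (@loc_annih c _ (('X - d%:P) ^+ n)).
- exact: locM.
- by rewrite rootE horner_exp hornerXsubC expf_neq0 // subr_eq0.
- by rewrite -mulrA mulrC; exact: annihM.
Qed.

(** A dependence among the x^b_k gives X^b[p] = 0, and commuting with [theta] propagates this to all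
    multiples of p. The product over the two signs serves both currents. *)
Lemma annih_exists : exists2 m, m != 0 & annih m.
Proof.
have Mb b : exists2 p, p != 0 & forall q, X b (p * q) = 0.
  have [p p0 Xp] := ev_dependent (x b); exists p => // q.
  have XM r : X b r = 0 -> X b (r * 'X) = 0.
    move=> Xr; apply/lfunP => v; have := theta_x e_neq0 sys 0 b r v.
    rewrite Xr !zero_lfunE linear0 add0r subr0 => /esym/eqP.
    by rewrite scaler_eq0; case: (b); rewrite /pm ?oppr_eq0 oner_eq0 => /eqP.
  apply: (@linear_poly0 _ _ (fun q => X b (p * q))) => [c r s|k].
    by rewrite polyMlinr linearP.
  by elim: k => [|k IHk]; rewrite ?mulr1 // exprSr mulrA; exact: XM.
have [[p p0 pA] [q q0 qA]] := (Mb true, Mb false).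
exists (p * q) => [|[] r]; first by rewrite mulf_neq0.
  by rewrite -mulrA pA.
by rewrite [p * q]mulrC -mulrA qA.
Qed.

(** Partial fractions: the factors of an annihilating polynomial are split off one root at a time,
    all copies of the root [c] together, and Bezout separates its component from the rest. *)
Lemma loc_sum (P : {poly F} -> Prop) :
    (forall p q, P p -> P q -> P (p + q)) -> (forall c p, loc c p -> P p) ->
  forall p, P p.
Proof.
move=> PD Ploc p; have [m m0 mA] := annih_exists.
have [s sE] := closed_field_poly_normal m.
have: annih (p * \prod_(z <- s) ('X - z%:P)).
  have -> : p * \prod_(z <- s) ('X - z%:P) = m * ((lead_coef m)^-1 *: p).
    rewrite [Y in _ = Y * _]sE -scalerAl -scalerAr scalerA.
    by rewrite mulfV ?lead_coef_eq0 // scale1r mulrC.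
  exact: annihM.
have [n] := ubnP (size s); elim: n => // n IHn in (s) p {sE} *.
(* With no factor left, [p] annihilates the currents and is local at every point; 0 is an arbitrary
   choice. *)
case: s => [_|c s]; first by rewrite big_nil => pA; apply: (Ploc 0); exists 0%N.
rewrite big_cons (bigID (pred1 c)) /= => lt_sn.
set g := \prod_(i <- s | i != c) _; set f := \prod_(i <- s | _) _.
have -> : f = ('X - c%:P) ^+ (count_mem c s).
  rewrite /f (eq_bigr (fun=> 'X - c%:P)) => [|i /eqP -> //].
  by rewrite big_const_seq iter_mulr_1.
rewrite [_ * (_ ^+ _ * _)]mulrA -exprS; set h := _ ^+ _ => pA.
have /Bezout_eq1_coprimepP[[u v] /= uv1] : coprimep h g.
  rewrite coprimep_expl // coprimep_sym coprimep_XsubC /g -big_filter.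
  by rewrite root_prod_XsubC mem_filter eqxx.
rewrite -[p]mulr1 -uv1 mulrDr; apply: PD.
  apply: (IHn [seq i <- s | i != c]).
    by rewrite size_filter (leq_ltn_trans (count_size _ _)) // -ltnS.
  rewrite big_filter -/g [u * h]mulrC mulrA mulrAC -[p * h * g]mulrA.
  exact: annihM.
apply: (Ploc c); exists (count_mem c s).+1.
rewrite -/h [v * g]mulrC mulrA mulrAC -[p * g * h]mulrA [g * h]mulrC.
exact: annihM.
Qed.

(** Writing ['X] as d + ('X - d) on [p] and c + ('X - c) on [q], the quadratic relation equates (d -
    c - pm b kap) X[p] X[q] with terms in the opposite order and terms of smaller pole order.
    Induction on the sum of the orders. *)
Lemma x_reorder b c d p q v (P : V -> Prop) :
    lin_closed P -> d - c != pm b * kap -> loc d p -> loc c q ->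
    (forall p' q', loc d p' -> loc c q' -> P (X b q' (X b p' v))) ->
  P (X b p (X b q v)).
Proof.
move=> Plin neq_dc pd qc PX.
have P0 : P 0 := lin_closed0 Plin (PX _ _ pd qc).
move: (pd) (qc) => [n pn] [k qk].
have [N] := ubnP (n + k); elim: N => // N IHN in n k p q pd qc pn qk *.
case: n => [|n] in pn *.
  by move: pn; rewrite mulr1 => /annih_eq0 ->; rewrite zero_lfunE.
case: k => [|k] in qk *.
  by move: qk; rewrite mulr1 => /annih_eq0 ->; rewrite zero_lfunE linear0.
rewrite addSn addnS !ltnS => lt_nkN.
have t0 : d - c - pm b * kap != 0 by rewrite subr_eq0.
have XB z r w : X b (r * 'X) w = X b (r * ('X - z%:P)) w + z *: X b r w.
  by rewrite mulrBr [r * _%:P]mulrC mul_polyC linearB linearZ; vring.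
have -> : X b p (X b q v) = (d - c - pm b * kap)^-1 *:
    (X b q (X b (p * 'X) v) - X b (q * 'X) (X b p v)
       + (pm b * kap) *: X b q (X b p v)
     - X b (p * ('X - d%:P)) (X b q v) + X b p (X b (q * ('X - c%:P)) v)).
  apply: (scalerI t0); rewrite scalerA mulfV // scale1r -(xx_poly sys).
  by rewrite (XB d p) (XB c q); vring.
apply: lin_closedZ => //.
apply: lin_closedD => //; first apply: lin_closedB => //.
- apply: lin_closedD => //; last by apply: lin_closedZ => //; exact: PX.
  by apply: lin_closedB => //; apply: PX => //; exact: locM.
- apply: (IHN n k.+1) => //; rewrite ?addnS ?(leq_ltn_trans _ lt_nkN) //.
    exact: locM.
  by rewrite -mulrA -exprS.
- apply: (IHN n.+1 k) => //; first exact: locM.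
  by rewrite -mulrA -exprS.
Qed.

End RankOneLocal.

Lemma seq_min (T : eqType) (R : realDomainType) (f : T -> R) (Q : T -> Prop)
    (s : seq T) :
    (exists2 y, y \in s & Q y) ->
  exists2 y, Q y & forall z, z \in s -> Q z -> f y <= f z.
Proof.
elim: s => [[y]|t s IHs [y ys Qy]]; first by rewrite in_nil.
case: (pselect (exists2 z, z \in s & Q z)) => [/IHs[z Qz zmin]|nos].
  case: (pselect (Q t /\ f t <= f z)) => [[Qt le_tz]|not_t].
    exists t => // w; rewrite inE => /predU1P[->|ws Qw] //.
    exact: le_trans le_tz (zmin _ ws Qw).
  exists z => // w; rewrite inE => /predU1P[-> Qt|]; last exact: zmin.
  by case: (leP (f z) (f t)) => // /ltW le_tz; case: not_t.
exists y => // z; rewrite inE => /predU1P[->|zs Qz]; last by case: nos; exists z.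
by move: ys; rewrite inE => /predU1P[->|ys _] //; case: nos; exists y.
Qed.

(** * Regularity on irreducible modules *)

Section Irreducible.
Variables (F : numClosedFieldType) (e kap : F).
Hypothesis e_neq0 : e != 0.
Variables (V : vectType F) (xi : nat -> 'End(V)) (x : bool -> nat -> 'End(V)).
Hypothesis sys : rank_one e kap xi x.
Variables (R : realFieldType) (ell : {additive F -> R}).
Hypothesis ell_kap : ell kap = 1.
Variable a : F.

Local Notation X b p := (ev (x b) p).
Local Notation Xi p := (ev xi p).
Local Notation annih := (annih x).
Local Notation loc := (loc x).
Local Notation theta := (theta e kap xi a).

(* [X b p] with [loc c p] shifts the eigenvalues of [theta] by a number with
   image [dir b c] under [ell]. *)
Definition dir b c : R := pm b * ell (c - a).

Lemma ell_pm b c : ell (pm b * c) = pm b * ell c.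
Proof. by case: b; rewrite /pm ?mul1r // !mulN1r raddfN. Qed.

(** Equality would give [dir b d = dir b c + 1], since [ell kap = 1]. Hence a lowering component
    always moves past a raising one of the same sign. *)
Lemma dir_reorder b c d : dir b d < 0 -> 0 < dir b c -> d - c != pm b * kap.
Proof.
rewrite /dir => lt_d lt_c; apply: contraTneq isT => dc.
have : pm b * ell (d - a) = pm b * ell (c - a) + 1.
  have -> : d - a = (c - a) + pm b * kap by rewrite -dc; ring.
  by rewrite raddfD mulrDr ell_pm ell_kap mulr1 pm_sqr.
lra.
Qed.

Inductive span_up (K : V -> Prop) : V -> Prop :=
| span_up_base v : K v -> span_up K v
| span_up_lin c u v : span_up K u -> span_up K v -> span_up K (c *: u + v)
| span_up_op b c p v :
    0 < dir b c -> loc c p -> span_up K v -> span_up K (X b p v).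

Lemma span_up_closed K : lin_closed (span_up K).
Proof. by move=> c u v; exact: span_up_lin. Qed.

(** Induction on [r]: [xix_poly] rewrites xi_(r+1) X[p] through words starting with X and words
    starting with xi_r, in which [p] may become [p * 'X], still local at [c]. *)
Lemma span_up_xiX K c b p v :
    loc c p ->
    (forall q, loc c q -> forall w, w = v \/ (exists r, w = xi r v) ->
      span_up K (X b q w)) ->
  forall r, span_up K (xi r (X b p v)).
Proof.
move=> pc KX r; have linK := @span_up_closed K.
elim: r p pc => [|r IHr] p pc.
  rewrite (xi0x_poly sys); apply: lin_closedD => //.
    by apply: KX => //; right; exists 0%N.
  by apply: lin_closedZ => //; apply: KX => //; left.
have -> : xi r.+1 (X b p v) = X b p (xi r.+1 v) + xi r (X b (p * 'X) v)
    - X b (p * 'X) (xi r v) + (pm b * kap) *: (xi r (X b p v) + X b p (xi r v)).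
  by rewrite (xix_poly sys); vring.
have pXc : loc c (p * 'X) by exact: locM.
apply: lin_closedD => //; first apply: lin_closedB => //.
- by apply: lin_closedD; [|apply: KX => //; right; exists r.+1|exact: IHr].
- by apply: KX => //; right; exists r.
- apply: lin_closedZ => //; apply: lin_closedD; [by []|exact: IHr|].
  by apply: KX => //; right; exists r.
Qed.

Lemma span_up_xi K : (forall v r, K v -> span_up K (xi r v)) ->
  forall v r, span_up K v -> span_up K (xi r v).
Proof.
move=> Kxi v r Kv.
elim: Kv r => {v} [v Kv r|c u v _ IHu _ IHv r|b c p v bc pc Kv IHv].
- exact: Kxi.
- by rewrite lfunD lfunZ; apply: span_up_lin.
- apply: (@span_up_xiX K c) => // q qc w [->|[s ->]]; exact: (span_up_op bc qc).
Qed.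

(** A lowering component is moved to the right: past the same sign by [x_reorder], past the opposite
    sign at the cost of some [Xi], which preserves the span. *)
Lemma span_up_down K :
    (forall v r, K v -> span_up K (xi r v)) ->
    (forall v b c p, K v -> dir b c < 0 -> loc c p -> X b p v = 0) ->
  forall v b c p, dir b c < 0 -> loc c p -> span_up K v -> span_up K (X b p v).
Proof.
move=> Kxi Kdown v b c p bc pc Kv; have linK := @span_up_closed K.
elim: Kv b c p bc pc => {v}
  [v Kv|k u v _ IHu _ IHv|b' c' p' v bc' pc' Kv IHv] b c p bc pc.
- rewrite (Kdown v b c) //; apply: lin_closed0 (linK) _; exact: span_up_base Kv.
- rewrite lfunD lfunZ.
  by apply: span_up_lin; [exact: IHu bc pc|exact: IHv bc pc].
have [eq_b|neq_b] := eqVneq b b'.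
  rewrite -{b'}eq_b in bc' *.
  apply: (x_reorder sys linK (dir_reorder bc bc') pc pc').
  by move=> q q' qc qc'; apply: span_up_op bc' qc' _; exact: IHv bc qc.
have {neq_b} eq_b : b' = ~~ b by case: b b' neq_b {bc bc'} => [] [].
rewrite {}eq_b in bc' *; rewrite (x_opp_comm sys); apply: lin_closedD => //.
  by apply: span_up_op bc' pc' _; exact: IHv bc pc.
apply: lin_closedZ => //; apply: lin_closed_ev => // k.
exact: span_up_xi.
Qed.

(** Stability under the xi_r follows from xi_r = [x^+_r, x^-_0]. The zero space is irreducible in
    this sense. *)
Definition irreducible := forall P : V -> Prop, lin_closed P ->
  (forall b r, stable (x b r) P) -> (exists2 v, v != 0 & P v) -> forall v, P v.

(** No pole lies on the line ell = ell a, so every nonzero component is raising or lowering and the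
    span is a submodule. *)
Lemma span_up_all m K w : irreducible ->
    m != 0 -> annih m -> (forall c, root m c -> ell (c - a) != 0) ->
    (forall v r, K v -> span_up K (xi r v)) ->
    (forall v b c p, K v -> dir b c < 0 -> loc c p -> X b p v = 0) ->
  K w -> w != 0 -> forall v, span_up K v.
Proof.
move=> irr m0 mA ella Kxi Kdown Kw w0; have linK := @span_up_closed K.
apply: irr => // [b r v Kv|]; last by exists w => //; exact: span_up_base.
rewrite -(evXn (x b)).
apply: (@loc_sum _ _ _ e_neq0 _ _ _ sys (fun p => span_up K (X b p v)))
  => [p q|c p pc].
  by rewrite linearD add_lfunE; exact: lin_closedD.
have [mc|mc] := boolP (root m c); last first.
  rewrite (annih_eq0 b (loc_annih pc mc _)) ?zero_lfunE.
    exact: lin_closed0 Kv.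
  by rewrite mulrC; exact: annihM.
have [||dir0] := ltgtP (dir b c) 0.
- by move=> bc; apply: span_up_down bc pc Kv.
- by move=> bc; apply: span_up_op bc pc Kv.
- have := ella _ mc; rewrite -[ell _]mul1r -(pm_sqr R b) -mulrA -/(dir b c).
  by rewrite dir0 mulr0 eqxx.
Qed.

(* The span of the generalized eigenvectors of [theta] whose eigenvalues have
   image greater than [l0] under [ell]. *)
Inductive above (l0 : R) : V -> Prop :=
| above0 : above l0 0
| aboveS mu v : l0 < ell mu -> above l0 (theta v - mu *: v) -> above l0 v.

Lemma above_theta l0 nu v : above l0 v -> above l0 (theta v - nu *: v).
Proof.
elim=> {v} [|mu v lt_mu _ IHv].
  by rewrite linear0 scaler0 subrr; exact: above0.
by apply: aboveS lt_mu _; rewrite (_ : _ - _ =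
  theta (theta v - mu *: v) - nu *: (theta v - mu *: v)) //; vring.
Qed.

Lemma aboveZ l0 c v : above l0 v -> above l0 (c *: v).
Proof.
elim=> {v} [|mu v lt_mu _ IHv]; first by rewrite scaler0; exact: above0.
apply: aboveS lt_mu _.
by rewrite (_ : _ - _ = c *: (theta v - mu *: v)) //; vring.
Qed.

Lemma aboveD l0 v w : above l0 v -> above l0 w -> above l0 (v + w).
Proof.
move=> av; elim: av w => {v} [|mu v lt_mu _ IHv] w aw; first by rewrite add0r.
apply: aboveS lt_mu _; rewrite (_ : _ - _ =
  (theta v - mu *: v) + (theta w - mu *: w)); last by vring.
by apply: IHv; exact: above_theta.
Qed.

Lemma theta_loc b c p v : theta (X b p v) =
  X b p (theta v) + (pm b * (c - a)) *: X b p v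
    + pm b *: X b (p * ('X - c%:P)) v.
Proof.
rewrite (theta_x e_neq0 sys) -addrA; congr (_ + _).
rewrite (_ : 'X - a%:P = (c - a)%:P + ('X - c%:P)); last by rewrite polyCB; ring.
by rewrite mulrDr [p * _%:P]mulrC mul_polyC linearD linearZ; vring.
Qed.

(** Subtracting the shifted eigenvalue from [theta] either advances the derivation of [above] for
    [v] or lowers the order of [p] at [c]; hence a double induction. *)
Lemma above_up l0 v b c p :
  0 < dir b c -> loc c p -> above l0 v -> above l0 (X b p v).
Proof.
move=> bc pc av; elim: av p pc => {v} [|mu v lt_mu _ IHv] p pc.
  by rewrite linear0; exact: above0.
case: (pc) => n; elim: n p pc => [|n IHn] p pc pn.
  by move: pn; rewrite mulr1 => /annih_eq0 ->; rewrite zero_lfunE; exact: above0.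
apply: (@aboveS _ (mu + pm b * (c - a))).
  by rewrite raddfD ell_pm -/(dir b c); lra.
rewrite (theta_loc b c) (_ : _ - _ = X b p (theta v - mu *: v) +
  pm b *: X b (p * ('X - c%:P)) v); last by vring.
apply: aboveD; first exact: IHv.
by apply/aboveZ/IHn; [exact: locM|rewrite -mulrA -exprS].
Qed.

Lemma above_up_eigen lam v b c p :
    theta v = lam *: v -> 0 < dir b c -> loc c p -> above (ell lam) (X b p v).
Proof.
move=> tv bc pc; case: (pc) => n; elim: n p pc => [|n IHn] p pc pn.
  by move: pn; rewrite mulr1 => /annih_eq0 ->; rewrite zero_lfunE; exact: above0.
apply: (@aboveS _ (lam + pm b * (c - a))).
  by rewrite raddfD ell_pm -/(dir b c); lra.
rewrite (theta_loc b c) tv (_ : _ - _ = pm b *: X b (p * ('X - c%:P)) v);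
  last by vring.
by apply/aboveZ/IHn; [exact: locM|rewrite -mulrA -exprS].
Qed.

Lemma above_eigen lam v : theta v = lam *: v -> above (ell lam) v -> v = 0.
Proof.
move=> + av; elim: av => {v} [//|mu v lt_mu _ IHv tv].
have /eqP : theta v - mu *: v = 0.
  by apply: IHv; rewrite tv -scalerBl lfunZ tv !scalerA mulrC.
rewrite tv -scalerBl scaler_eq0 subr_eq0 => /orP[/eqP lam_mu|/eqP //].
by rewrite lam_mu ltxx in lt_mu.
Qed.

Lemma theta_eigenvalues : exists p : {poly F}, p != 0 /\
  forall lam (v : V), v != 0 -> theta v = lam *: v -> root p lam.
Proof.
have [p p0 pE] := ev_dependent (fun k => iter k (comp_lfun theta) \1%VF).
exists p; split=> // lam v v0 tv; apply/rootP/eqP.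
have := congr1 (fun f : 'End(V) => f v) pE.
rewrite /ev sum_lfunE zero_lfunE => /eqP.
rewrite (eq_bigr (fun k : 'I_(size p) => (p`_k * lam ^+ k) *: v)) => [|k _].
  by rewrite -scaler_suml -horner_coef scaler_eq0 (negPf v0) orbF.
rewrite scale_lfunE -scalerA; congr (_ *: _).
elim: (k : nat) => [|i IHi] /=; first by rewrite id_lfunE scale1r.
by rewrite comp_lfunE IHi linearZ /= tv scalerA exprSr.
Qed.

(** Take an eigenvalue of [theta] with minimal image under [ell] and a joint eigenvector of the xi_r
    in its eigenspace. A nonzero image under a lowering component would yield a smaller
    eigenvalue. *)
Lemma extremal_vector (v0 : V) : v0 != 0 ->
  exists (c : nat -> F) (lam : F) (u : V),
  [/\ u != 0, forall r, xi r u = c r *: u, theta u = lam *: u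
    & forall b d p, dir b d < 0 -> loc d p -> X b p u = 0].
Proof.
move=> v00; have [p [p0 pE]] := theta_eigenvalues.
have [s sE] := closed_field_poly_normal p.
have pP lam v : v != 0 -> theta v = lam *: v -> lam \in s.
  move=> vn0 /(pE _ _ vn0).
  by rewrite sE rootZ ?lead_coef_eq0 // root_prod_XsubC.
pose Q lam := exists2 v, v != 0 & theta v = lam *: v.
have triv : stable theta (fun=> True) by [].
have [lam0 [w0 [_ w00 tw0]]] :=
  eigenvector_exists triv (fun _ _ _ _ _ => I) I v00.
have [|lam [w wn0 tw] lam_min] := @seq_min _ _ ell Q s.
  by exists lam0; [exact: pP tw0|exists w0].
have comm r v : theta (xi r v) = xi r (theta v).
  rewrite /theta; lfun_expand.
  by rewrite !(r1_xixi sys _ r).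
have [||c [u [tu u0 xu]]] := joint_eigenvector (A := xi)
    (P := fun v => theta v = lam *: v) (r1_xixi sys) _ _ tw wn0.
- by move=> r v tv; rewrite comm tv linearZ.
- by move=> k v1 v2 tv1 tv2; rewrite linearP /= tv1 tv2 scalerDr !scalerA mulrC.
exists c, lam, u; split=> // b d q bd qd.
case: (qd) => n; elim: n q qd => [|n IHn] q qd qn.
  by move: qn; rewrite mulr1 => /annih_eq0 ->; rewrite zero_lfunE.
apply/eqP; apply: contraT => Xu0.
have tX : theta (X b q u) = (lam + pm b * (d - a)) *: X b q u.
  have X0 : X b (q * ('X - d%:P)) u = 0.
    by apply: IHn; [exact: locM|rewrite -mulrA -exprS].
  by rewrite (theta_loc b d) tu X0; vring.
have Qd : Q (lam + pm b * (d - a)) by exists (X b q u).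
have := lam_min _ (pP _ _ Xu0 tX) Qd.
by rewrite raddfD ell_pm leNgt => /negP[]; move: bd; rewrite /dir; lra.
Qed.

Section Regular.
Variables (m q0 : {poly F}) (z : F).
Hypotheses (m_neq0 : m != 0) (mA : annih m).
Hypothesis ell_root : forall c, root m c -> ell (c - a) != 0.
Hypotheses (ell_z : ell (z - a) < 0) (ell_zkap : 0 < ell (z + kap - a)).
Hypotheses (q0z : ~~ root q0 z).
Hypothesis nilp : forall r v, exists k, iter k (Xi (q0 * r)) v = 0.
Hypothesis irr : irreducible.

Lemma irreducible_regular b p : loc z p -> X b p = 0.
Proof.
move: b p; apply: contrapT => notX.
have [v0 v00] : exists v : V, v != 0.
  apply: contrapT => noV; apply: notX => b p _; apply/lfunP => v.
  by rewrite zero_lfunE; apply: contrapT => /eqP X0; apply: noV; exists (X b p v).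
have [c [lam [u [u0 xu tu downu]]]] := extremal_vector v00.
(* At [z] the component of x^- is raising and that of x^+ is lowering. *)
have dirz : 0 < dir false z by rewrite /dir /pm mulN1r oppr_gt0.
(* [J p] says that [p] times the eigenvalue series on [u] is a polynomial. It holds for [q0] by
   nilpotency, hence by coprimality for every [p] local at [z]. *)
pose J p := forall r, Xi (p * r) u = 0.
have Xiu p : Xi p u = (\sum_(k < size p) p`_k * c k) *: u.
  rewrite /ev sum_lfunE scaler_suml; apply: eq_bigr => k _.
  by rewrite scale_lfunE xu scalerA.
have Jq0 : J q0.
  move=> r; have [k] := nilp r u; rewrite Xiu; set t := \sum_(_ < _) _.
  have -> : iter k (Xi (q0 * r)) u = t ^+ k *: u.
    elim: k => [|k IHk]; first by rewrite scale1r.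
    by rewrite iterS IHk linearZ /= Xiu scalerA -exprSr.
  move=> /eqP; rewrite scaler_eq0 (negPf u0) orbF expf_eq0 => /andP[_ /eqP ->].
  by rewrite scale0r.
have Jloc p : loc z p -> J p.
  move=> [n pn]; apply: (@coprime_ideal _ J p q0 (('X - z%:P) ^+ n)).
  - by move=> q r Jq Jr s; rewrite mulrDl linearD add_lfunE Jq Jr addr0.
  - by move=> q r Jq s; rewrite -mulrA.
  - by rewrite coprimep_expr // coprimep_XsubC.
  - by move=> r; rewrite [p * q0]mulrC -mulrA.
  - by move=> r; rewrite (annih_Xi sys) ?zero_lfunE //; exact: annihM.
have Xi_loc p : loc z p -> Xi p u = 0 by move/Jloc => /(_ 1); rewrite mulr1.
(* If nonzero, this vector would generate V by raising components, and all of V, including [u],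
   would lie strictly above [ell lam]. *)
have Xfu p : loc z p -> X false p u = 0.
  move=> pz; apply: contrapT => /eqP Xu0.
  pose K v := exists2 q, loc z q & v = X false q u.
  have KX q k : loc z q -> span_up K (X false q (k *: u)).
    move=> qz; rewrite lfunZ; apply: lin_closedZ; first exact: span_up_closed.
    by apply: span_up_base; exists q.
  suff au : above (ell lam) u by rewrite (above_eigen tu au) eqxx in u0.
  have : span_up K u.
    apply: (@span_up_all m K (X false p u)) => //.
    - move=> _ r [q qz ->].
      apply: (span_up_xiX qz) => q' q'z _ [->|[s ->]].
        by rewrite -[u]scale1r; exact: KX.
      by rewrite xu; exact: KX.
    (* Lowering components of x^+ produce an [Xi] term that is zero on [u]; those of x^- are moved
       to the right, onto [u]. *)
    - move=> _ b d q [q' q'z ->] bd qd; case: b bd => bd.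
        rewrite (x_opp_comm sys) /= (downu true d) // linear0 add0r.
        by rewrite mulrC Xi_loc ?scaler0 //; exact: locM.
      apply: (x_reorder sys (P := fun v => v = 0) _ (dir_reorder bd dirz) qd q'z).
        by move=> k v w -> ->; rewrite scaler0 addr0.
      by move=> r s rd sz; rewrite (downu false d) // linear0.
    - by exists p.
  elim=> {p pz Xu0} [_ [q qz ->]|k v w _ av _ aw|b d q w bd qd _ aw].
  - exact: above_up_eigen tu dirz qz.
  - by apply: aboveD => //; exact: aboveZ.
  - exact: above_up bd qd aw.
have spanu : forall v, span_up (fun v => v = u) v.
  apply: (@span_up_all m _ u) => //.
  - move=> _ r ->; rewrite xu; apply: lin_closedZ; first exact: span_up_closed.
    exact: span_up_base.
  - by move=> _ b d q -> bd qd; exact: downu bd qd.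
apply: notX => b p pz; apply/lfunP => v; rewrite zero_lfunE.
elim: (spanu v) b p pz => {v}
  [_ ->|k v w _ IHv _ IHw|b' d q v bd qd _ IHv] b p pz.
- by case: b; [apply: (downu true z) => //; rewrite /dir mul1r|exact: Xfu].
- by rewrite lfunD lfunZ IHv // IHw // scaler0 addr0.
have [eq_b|neq_b] := eqVneq b b'.
  rewrite -{b'}eq_b in bd *.
  apply: (x_reorder sys (P := fun v => v = 0) _ _ pz qd).
  - by move=> k v1 w -> ->; rewrite scaler0 addr0.
  (* The obstruction sits at z - kap for x^+ and at z + kap for x^-. As [a] separates [z] from z +
     kap, neither component is raising. *)
  - apply: contraTneq bd => zd; rewrite -leNgt /dir.
    have -> : d = z - pm b * kap by rewrite -zd; ring.
    case: (b); rewrite /pm ?mul1r ?mulN1r ?opprK.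
      have -> : z - kap - a = (z - a) - kap by ring.
      by rewrite raddfB ell_kap subr_le0 (le_trans (ltW ell_z)) ?ler01.
    by rewrite oppr_le0 ltW.
  - by move=> p' q' p'z q'd; rewrite IHv // linear0.
have {neq_b} eq_b : b' = ~~ b by case: b b' neq_b {bd} => [] [].
rewrite {}eq_b in bd *; have [eq_d|neq_d] := eqVneq d z.
  by rewrite eq_d in qd; rewrite (IHv (~~ b)) // linear0.
rewrite (x_opp_comm sys) (IHv b) // linear0 add0r.
rewrite (annih_Xi sys) ?zero_lfunE ?scaler0 //.
by apply: loc_disjoint pz qd; rewrite eq_sym.
Qed.

End Regular.

End Irreducible.

(** Applying [A - lam n] removes the last term and multiplies the others by nonzero scalars. *)
Lemma eigen_sum0 (F : fieldType) (W : lmodType F) (A : W -> W) (lam : nat -> F)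
    (w : nat -> W) n :
    linear A -> injective lam -> (forall k, A (w k) = lam k *: w k) ->
  \sum_(k < n) w k = 0 -> forall k, (k < n)%N -> w k = 0.
Proof.
move=> Alin lam_inj; have AD u v : A (u + v) = A u + A v.
  by have := Alin 1 u v; rewrite !scale1r.
have A0 : A 0 = 0 by have := Alin (-1) 0 0; rewrite !scaleN1r oppr0 addr0 addNr.
have AZ c u : A (c *: u) = c *: A u by have := Alin c u 0; rewrite A0 !addr0.
elim: n w => [//|n IHn] w Aw sum0 k lt_kn.
have w0 j : (j < n)%N -> w j = 0.
  move=> lt_jn; have : (lam j - lam n) *: w j = 0.
    apply: (IHn (fun i => (lam i - lam n) *: w i)) lt_jn => [i|].
      by rewrite AZ Aw !scalerA mulrC.
    have : A (\sum_(i < n.+1) w i) - lam n *: \sum_(i < n.+1) w i = 0.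
      by rewrite sum0 A0 scaler0 subrr.
    rewrite (big_morph A AD A0) scaler_sumr -sumrB big_ord_recr /= Aw subrr addr0.
    by move=> s0; rewrite -[RHS]s0; apply: eq_bigr => i _; rewrite Aw scalerBl.
  move=> /eqP; rewrite scaler_eq0 subr_eq0 => /orP[/eqP/lam_inj jn|/eqP //].
  by rewrite jn ltnn in lt_jn.
move: lt_kn; rewrite ltnS leq_eqVlt => /predU1P[->|/w0 //].
by move: sum0; rewrite big_ord_recr /= big1 ?add0r // => i _; exact: w0.
Qed.

Definition lfun_br (F : fieldType) (V : vectType F) (f g : 'End(V)) : 'End(V) :=
  (f \o g)%VF - (g \o f)%VF.

Lemma lfun_brE (F : fieldType) (V : vectType F) (f g : 'End(V)) v :
  lfun_br f g v = f (g v) - g (f v).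
Proof. by rewrite /lfun_br add_lfunE opp_lfunE !comp_lfunE. Qed.

(** * Extremal vectors in End(V) *)

Section LowestWeight.
Variables (F : numClosedFieldType) (e kap : F).
Hypothesis e_neq0 : e != 0.
Variables (V : vectType F) (xi : nat -> 'End(V)) (x : bool -> nat -> 'End(V)).
Hypothesis sys : rank_one e kap xi x.

(* [E] is a lowest weight vector of positive weight in the finite-dimensional
   sl_2-module End(V). *)
Lemma lowest_weight_eq0 b (E : 'End(V)) :
    (forall v, xi 0%N (E v) = E (xi 0%N v) + (pm b * e) *: E v) ->
    (forall v, E (x (~~ b) 0%N v) = x (~~ b) 0%N (E v)) ->
  E = 0.
Proof.
move=> Ewt Elow; pose y := x b 0%N; pose f := x (~~ b) 0%N.
pose Ek k := iter k (lfun_br y) E.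
have EkS k v : Ek k.+1 v = y (Ek k v) - Ek k (y v) by exact: lfun_brE.
have ywt v : xi 0%N (y v) = y (xi 0%N v) + (pm b * e) *: y v.
  by rewrite -(r1_xi0x sys) addrC subrK.
have fy v : f (y v) = y (f v) - pm b *: xi 0%N v.
  have := x_opp_comm sys b 1 1 v.
  by rewrite mulr1 !ev1 -/f -/y => ->; rewrite addrK.
pose lam k : F := pm b * e * k.+1%:R.
have Ekwt k v : xi 0%N (Ek k v) = Ek k (xi 0%N v) + lam k *: Ek k v.
  elim: k v => [|k IHk] v; first by rewrite /lam mulr1 Ewt.
  rewrite !EkS; lfun_expand; rewrite ywt !IHk ywt /lam -[k.+2]addn1 natrD.
  by vring.
(* This is the coefficient in [f, E_k] = c_k E_(k-1), obtained by adding up the weights [lam]. *)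
pose c k : F := - e * (\sum_(j < k) j.+1%:R).
have Eklow k v : f (Ek k v) =
    Ek k (f v) + c k *: (if k is j.+1 then Ek j v else 0).
  elim: k v => [|k IHk] v; first by rewrite scaler0 addr0 Elow.
  rewrite !EkS lfunD lfunN fy IHk (IHk (y v)) fy Ekwt.
  have cS : c k.+1 = c k - e * k.+1%:R.
    by rewrite /c big_ord_recr /= mulrDr -mulNr.
  have cE : c k *: Ek k v =
      c k *: (y (if k is j.+1 then Ek j v else 0) -
              (if k is j.+1 then Ek j (y v) else 0)).
    by case: (k) => [|j]; [rewrite /c big_ord0 mulr0 !scale0r|rewrite EkS].
  have ss : pm b * lam k = e * k.+1%:R by rewrite /lam !mulrA pm_sqr mul1r.
  rewrite cS scalerBl cE -ss; vring.
(* The [Ek k] have distinct weights under ad xi_0, so a dependence forces the one at its leading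
   coefficient to vanish. *)
have [p p0 sum0] := ev_dependent Ek.
have [k Ek0] : exists k, Ek k = 0.
  exists (size p).-1; apply/eqP; rewrite -[_ == 0]orFb.
  rewrite -(negPf p0) -lead_coef_eq0 -scaler_eq0; apply/eqP.
  apply: (@eigen_sum0 F _ (lfun_br (xi 0%N)) lam
    (fun k => p`_k *: Ek k) (size p)).
  - move=> k G H; apply/lfunP => v.
    by rewrite !(add_lfunE, scale_lfunE, lfun_brE); vring.
  - move=> i j /(mulfI _)/eqP; rewrite mulf_neq0 //.
      by rewrite eqr_nat eqSS => /(_ isT)/eqP.
    by case: (b); rewrite /pm ?oppr_eq0 oner_eq0.
  - move=> k; apply/lfunP => v.
    by rewrite !(scale_lfunE, lfun_brE, lfunZ) Ekwt; vring.
  - exact: sum0.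
  - by rewrite prednK // size_poly_gt0.
(* As [c k.+1] is nonzero, vanishing descends from [Ek k.+1] to [Ek k], and finally to [E]. *)
elim: k Ek0 => [//|k IHk] EkS0; apply: IHk; apply/lfunP => v.
have /eqP := Eklow k.+1 v.
rewrite EkS0 !zero_lfunE linear0 add0r eq_sym scaler_eq0.
rewrite mulf_eq0 oppr_eq0 (negPf e_neq0) -natr_sum pnatr_eq0 big_ord_recr /=.
by rewrite addn_eq0 andbF => /eqP.
Qed.

End LowestWeight.

(** * Submodules and quotients *)

Section Transfer.
Variables (F : numClosedFieldType) (e kap : F).
Variables (V W : vectType F).
Variables (xi : nat -> 'End(V)) (x : bool -> nat -> 'End(V)).
Variables (xi' : nat -> 'End(W)) (x' : bool -> nat -> 'End(W)).

Lemma rank_one_sub (f : 'Hom(W, V)) : injective f ->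
    (forall r w, f (xi' r w) = xi r (f w)) ->
    (forall b r w, f (x' b r w) = x b r (f w)) ->
  rank_one e kap xi x -> rank_one e kap xi' x'.
Proof.
move=> f_inj fxi fx sys.
split=> *; apply: f_inj; rewrite !(fxi, fx, lfunD, lfunN, lfunZ).
- exact: (r1_xixi sys).
- exact: (r1_xi0x sys).
- exact: (r1_xix sys).
- exact: (r1_xx sys).
- exact: (r1_xpxm sys).
Qed.

Lemma rank_one_quo (f : 'Hom(V, W)) : (forall w, exists v, f v = w) ->
    (forall r v, f (xi r v) = xi' r (f v)) ->
    (forall b r v, f (x b r v) = x' b r (f v)) ->
  rank_one e kap xi x -> rank_one e kap xi' x'.
Proof.
move=> f_surj fxi fx sys; split.
- move=> r s w; have [v <-] := f_surj w.
  by have := congr1 f (r1_xixi sys r s v); rewrite !fxi.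
- move=> b s w; have [v <-] := f_surj w.
  by have := congr1 f (r1_xi0x sys b s v);
    rewrite !(lfunD, lfunN, lfunZ, fxi, fx).
- move=> b r s w; have [v <-] := f_surj w.
  by have := congr1 f (r1_xix sys b r s v);
    rewrite !(lfunD, lfunN, lfunZ, fxi, fx).
- move=> b r s w; have [v <-] := f_surj w.
  by have := congr1 f (r1_xx sys b r s v);
    rewrite !(lfunD, lfunN, lfunZ, fxi, fx).
- move=> r s w; have [v <-] := f_surj w.
  by have := congr1 f (r1_xpxm sys r s v);
    rewrite !(lfunD, lfunN, lfunZ, fxi, fx).
Qed.

End Transfer.

Lemma ev_intertwine (F : fieldType) (V W : vectType F) (f : 'Hom(V, W))
    (y : nat -> 'End(V)) (y' : nat -> 'End(W)) p v :
  (forall r v, f (y r v) = y' r (f v)) -> f (ev y p v) = ev y' p (f v).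
Proof.
move=> fy; rewrite /ev !sum_lfunE linear_sum.
by apply: eq_bigr => k _; rewrite !scale_lfunE linearZ /= fy.
Qed.

Lemma iter_intertwine (S T : Type) (f : S -> T) (g : S -> S) (h : T -> T) k v :
  (forall v, f (g v) = h (f v)) -> f (iter k g v) = iter k h (f v).
Proof. by move=> fg; elim: k => //= k <-. Qed.

Section SubQuotient.
Variables (F : closedFieldType) (V : vectType F) (U : {vspace V}).

Definition sub_op (T : 'End(V)) : 'End(subvs_of U) :=
  linfun (vsproj U \o T \o vsval).

(** The quotient by [U] is realized on the complement [U^C], with the projection along [U] as
    quotient map. *)
Definition quo_map : 'Hom(V, subvs_of (U^C)%VS) :=
  (linfun (vsproj (U^C)%VS) \o daddv_pi (U^C)%VS U)%VF.

Definition quo_op (T : 'End(V)) : 'End(subvs_of (U^C)%VS) :=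
  linfun (quo_map \o T \o vsval).

Lemma sub_opE (T : 'End(V)) w : stable T (fun v => v \in U) ->
  linfun vsval (sub_op T w) = T (linfun vsval w) :> V.
Proof.
by move=> TU; rewrite !lfunE /= vsprojK //; apply: TU; exact: subvsP.
Qed.

Lemma capvCU : (U^C :&: U = 0)%VS. Proof. by rewrite capvC capv_compl. Qed.

Lemma quo_map_vsval w : quo_map (vsval w) = w.
Proof.
rewrite /quo_map comp_lfunE lfunE /= (daddv_pi_id capvCU) ?subvsP //.
exact: vsvalK.
Qed.

Lemma quo_map_sub v : v - vsval (quo_map v) \in U.
Proof.
have vCU : v \in (U^C + U)%VS by rewrite addvC addv_complf memvf.
have := daddv_pi_add capvCU vCU; rewrite /quo_map comp_lfunE lfunE /=.
rewrite vsprojK ?memv_pi // => {1}<-.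
by rewrite addrC addKr memv_pi.
Qed.

Lemma quo_map0 v : v \in U -> quo_map v = 0.
Proof.
move=> vU; apply/val_inj/eqP => /=.
rewrite -memv0 -capvCU memv_cap subvsP /=.
by rewrite -[vsval _](subKr v) memvB // quo_map_sub.
Qed.

Lemma quo_map0P v : quo_map v = 0 -> v \in U.
Proof. by move=> v0; have := quo_map_sub v; rewrite v0 [vsval 0]linear0 subr0. Qed.

Lemma quo_op_vsval (T : 'End(V)) w : quo_op T w = quo_map (T (vsval w)).
Proof. exact: lfunE. Qed.

Lemma quo_opE (T : 'End(V)) v : stable T (fun v => v \in U) ->
  quo_map (T v) = quo_op T (quo_map v).
Proof.
move=> TU; rewrite quo_op_vsval; apply/eqP.
rewrite -subr_eq0 -lfunN -lfunD -lfunN -lfunD; apply/eqP/quo_map0.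
exact: TU (quo_map_sub v).
Qed.

Lemma dim_quo : U != 0%VS -> (\dim {: subvs_of (U^C)%VS} < \dim {: V})%N.
Proof.
rewrite -dimv_eq0 -lt0n => U_gt0.
have -> : \dim {: subvs_of (U^C)%VS} = \dim (U^C)%VS by rewrite dimvf.
rewrite dimv_compl -[ltnRHS]subn0 ltn_sub2l //.
by rewrite (leq_trans U_gt0) // dimvS // subvf.
Qed.

Lemma dim_sub : U != fullv -> (\dim {: subvs_of U} < \dim {: V})%N.
Proof.
have -> : \dim {: subvs_of U} = \dim U by rewrite dimvf.
by rewrite (ltn_leqif (dimv_leqif_eq (subvf U))).
Qed.

End SubQuotient.

(** Candidates are a = z + kap/(k+2), for which ell (a - z) lies strictly between 0 and 1; among one
    more candidate than there are roots, one avoids them all. *)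
Lemma exists_shift (F : numClosedFieldType) (R : realFieldType)
    (ell : {additive F -> R}) (kap z : F) (m : {poly F}) :
    ell kap = 1 -> m != 0 ->
  exists a, [/\ ell (z - a) < 0, 0 < ell (z + kap - a)
    & forall c, root m c -> ell (c - a) != 0].
Proof.
move=> ell_kap m0; have [s sE] := closed_field_poly_normal m.
pose t k : F := kap / k.+2%:R.
have ell_t k : ell (t k) = k.+2%:R^-1.
  have k0 : k.+2%:R != 0 :> R by rewrite pnatr_eq0.
  have k0' : k.+2%:R != 0 :> F by rewrite pnatr_eq0.
  apply: (mulfI k0); rewrite mulfV // mulr_natl -raddfMn.
  by rewrite /t -[(kap / _) *+ _]mulr_natr divfK.
pose n := (size s).+1.
have [k _ ks] : exists2 k,
    k \in iota 0 n & k.+2%:R^-1 \notin [seq ell (c - z) | c <- s].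
  apply: contrapT => noK.
  have: uniq [seq (k.+2%:R^-1 : R) | k <- iota 0 n].
    rewrite map_inj_uniq ?iota_uniq // => i j /invr_inj/eqP.
    by rewrite eqr_nat !eqSS => /eqP.
  move=> /(@uniq_leq_size _ _ [seq ell (c - z) | c <- s]) H.
  suff: (n <= size s)%N by rewrite ltnn.
  rewrite -(size_map (fun c => ell (c - z))) -[leqLHS](size_iota 0).
  rewrite -(size_map (fun k => k.+2%:R^-1 : R)).
  apply: H => _ /mapP[k kn ->]; apply: contrapT => ks; apply: noK.
  by exists k => //; apply/negP.
have kV : k.+2%:R^-1 < 1 :> R by rewrite invf_lt1 ?ltr1n ?ltr0n.
exists (z + t k); split.
- by rewrite opprD addNKr raddfN ell_t oppr_lt0 invr_gt0 ltr0n.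
- have -> : z + kap - (z + t k) = kap - t k by ring.
  by rewrite raddfB ell_kap ell_t subr_gt0.
move=> c; rewrite sE rootZ ?lead_coef_eq0 // root_prod_XsubC => cs.
apply: contraNneq ks => c0; apply/mapP; exists c => //.
rewrite -ell_t; apply/esym/eqP; rewrite -subr_eq0 -raddfB.
by rewrite -[_ - t k]addrA -opprD c0.
Qed.

(** * Induction on the dimension *)

Section Main.
Variables (F : numClosedFieldType) (e kap : F).
Hypothesis e_neq0 : e != 0.
Variables (R : realFieldType) (ell : {additive F -> R}).
Hypothesis ell_kap : ell kap = 1.

(* Nilpotency, unlike the absence of a pole of the eigenvalues, passes directly
   to submodules and to quotients. *)
Lemma nilpotent_regular (V : vectType F) (xi : nat -> 'End(V))
    (x : bool -> nat -> 'End(V)) (q0 : {poly F}) (z : F) :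
    rank_one e kap xi x -> ~~ root q0 z ->
    (forall r v, exists k, iter k (ev xi (q0 * r)) v = 0) ->
  exists2 q, ~~ root q z & annih x q.
Proof.
have [n] := ubnP (\dim {: V}); elim: n => // n IHn in V xi x *.
rewrite ltnS => dimV sys q0z nilp.
have [m m0 mA] := annih_exists e_neq0 sys.
have [k [g]] := multiplicity_XsubC m z; rewrite m0 /= => gz mE.
have gloc r : loc x z (g * r).
  by exists k; rewrite mulrAC -mE; exact: annihM.
(* The part [g] of [m] prime to ['X - z] is local at [z], as are its multiples, so it becomes the
   required denominator. *)
suff xloc : forall b p, loc x z p -> ev (x b) p = 0.
  by exists g => // b r; exact: xloc.
have [irr|] := pselect (irreducible x).
  have [a [az azk ma]] := exists_shift z ell_kap m0.
  exact: (irreducible_regular e_neq0 sys ell_kap m0 mA ma az azk q0z nilp irr).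
move=> /existsNP[P /not_implyP[Plin /not_implyP[Px /not_implyP[[v v0 Pv]]]]].
move=> /existsNP[w notPw].
have [U UP] := vspace_of_closed (lin_closed0 Plin Pv) Plin.
have xU b r : stable (x b r) (fun v => v \in U) by move=> u /UP Pu; apply/UP/Px.
have xiU r : stable (xi r) (fun v => v \in U).
  move=> u uU; rewrite -[r]addn0 -(r1_xpxm sys).
  by rewrite memvB //; exact: xU (xU _ _ _ uU).
have U0 : U != 0%VS by apply: contraNneq v0 => U0; rewrite -memv0 -U0; apply/UP.
have UV : U != fullv.
  by apply: contra_notN notPw => /eqP UV; apply/UP; rewrite UV memvf.
pose iU : 'Hom(subvs_of U, V) := linfun vsval.
have iU_inj : injective iU by move=> u1 u2; rewrite !lfunE => /val_inj.
have iU_in u : u \in U -> iU (vsproj U u) = u.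
  by move=> uU; rewrite lfunE /= vsprojK.
pose xis r := sub_op U (xi r); pose xs b r := sub_op U (x b r).
have xisE r u : iU (xis r u) = xi r (iU u) by exact/sub_opE/xiU.
have xsE b r u : iU (xs b r u) = x b r (iU u) by exact/sub_opE/xU.
have [q1 q1z q1A] : exists2 q, ~~ root q z & annih xs q.
  apply: (IHn _ xis) => //.
  - exact: leq_trans (dim_sub UV) dimV.
  - exact: rank_one_sub iU_inj xisE xsE sys.
  move=> r u; have [i ui] := nilp r (iU u); exists i; apply: iU_inj.
  rewrite linear0 -ui; apply: iter_intertwine => u'.
  exact: ev_intertwine.
pose fU := quo_map U.
pose xiq r := quo_op U (xi r); pose xq b r := quo_op U (x b r).
have xiqE r u : fU (xi r u) = xiq r (fU u) by exact/quo_opE/xiU.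
have xqE b r u : fU (x b r u) = xq b r (fU u) by exact/quo_opE/xU.
have fU_surj u : exists u', fU u' = u by exists (vsval u); exact: quo_map_vsval.
have [q2 q2z q2A] : exists2 q, ~~ root q z & annih xq q.
  apply: (IHn _ xiq) => //.
  - exact: leq_trans (dim_quo U0) dimV.
  - exact: rank_one_quo fU_surj xiqE xqE sys.
  move=> r u; have [u' <-] := fU_surj u; have [i ui] := nilp r u'; exists i.
  rewrite -(linear0 fU) -ui; apply/esym/iter_intertwine => u''.
  exact: ev_intertwine.
have coprime_z q l : ~~ root q z -> coprimep q (('X - z%:P) ^+ l).
  by move=> qz; rewrite coprimep_expr // coprimep_XsubC.
(* [q1] annihilates on the submodule and [q2] on the quotient; their product does not vanish at [z],
   so Bezout removes it. *)
have xlocU b p : loc x z p ->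
    (forall u, u \in U -> ev (x b) p u = 0) /\ (forall u, ev (x b) p u \in U).
  move=> [l pl]; pose J q := forall r,
    (forall u, u \in U -> ev (x b) (q * r) u = 0) /\
    (forall u, ev (x b) (q * r) u \in U).
  suff Jp : J p by have := Jp 1; rewrite mulr1.
  apply: (@coprime_ideal _ J p (q1 * q2) (('X - z%:P) ^+ l)).
  - move=> q q' Jq Jq' r; have [JU JV] := Jq r; have [JU' JV'] := Jq' r.
    rewrite mulrDl linearD; split=> u; rewrite add_lfunE; last exact: memvD.
    by move=> uU; rewrite JU // JU' // addr0.
  - by move=> q q' Jq r; rewrite -mulrA.
  - by apply: coprime_z; rewrite rootM negb_or q1z.
  - move=> r; split=> u.
      move=> uU; rewrite -(iU_in u uU) -(ev_intertwine _ _ (xsE b)).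
      have -> : p * (q1 * q2) * r = q1 * (q2 * p * r) by ring.
      by rewrite q1A zero_lfunE linear0.
    apply: quo_map0P; rewrite (ev_intertwine _ _ (xqE b)).
    have -> : p * (q1 * q2) * r = q2 * (q1 * p * r) by ring.
    by rewrite q2A zero_lfunE.
  - by move=> r; rewrite pl; split=> u; rewrite zero_lfunE ?mem0v.

(* Two operators that kill [U] and map V into [U] have zero product. *)
have xi_locM p q : loc x z p -> loc x z q -> ev xi (p * q) = 0.
  move=> pz qz; apply/lfunP => u; rewrite -(xpxm_poly sys) zero_lfunE.
  have [pU pV] := xlocU true p pz; have [qU qV] := xlocU false q qz.
  by rewrite pU // qU // subrr.
(* The previous step with [g] as second factor, which is then removed by coprimality. *)
have xi_loc p : loc x z p -> ev xi p = 0.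
  move=> pz; case: (pz) => l pl; pose J q := forall r, ev xi (q * r) = 0.
  suff Jp : J p by have := Jp 1; rewrite mulr1.
  apply: (@coprime_ideal _ J p g (('X - z%:P) ^+ l)).
  - by move=> q q' Jq Jq' r; rewrite mulrDl linearD /= Jq Jq' addr0.
  - by move=> q q' Jq r; rewrite -mulrA.
  - exact: coprime_z.
  - by move=> r; rewrite -mulrA xi_locM.
  - by move=> r; rewrite (annih_Xi sys) //; exact: annihM.
(* Since [Xi p] vanishes, [X b p] commutes with the opposite x_0. *)
move=> b p pz; apply: (lowest_weight_eq0 e_neq0 sys (b := b)) => u.
  exact: (xi0x_poly sys).
rewrite -[x (~~ b) 0%N](ev1 (x (~~ b))) (x_opp_comm sys) mulr1 xi_loc //.
by rewrite zero_lfunE scaler0 addr0.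
Qed.

End Main.

(** For nonzero [c] this is an additive functional with value 1 at [c]; it will serve as [ell]. *)
Definition re_div (R : rcfType) (c z : R[i]) : R := complex.Re (z / c).

Lemma re_div_is_zmod_morphism (R : rcfType) (c : R[i]) :
  zmod_morphism (re_div c).
Proof.
by move=> y z; rewrite /re_div mulrBl; case: (y / c) (z / c) => [? ?] [? ?].
Qed.

HB.instance Definition _ (R : rcfType) (c : R[i]) :=
  GRing.isZmodMorphism.Build R[i] R (re_div c) (re_div_is_zmod_morphism c).

(** * Regularity expressed by denominators *)

Section GenSeries.
Variables (F : fieldType) (W : lmodType F).

Lemma evMXn (w : nat -> W) p j : ev w (p * 'X^j) = ev (fun k => w (k + j)%N) p.
Proof.
elim: j w => [|j IHj] w.
  by rewrite mulr1; apply: eq_bigr => k _; rewrite addn0.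
by rewrite exprSr mulrA evMX IHj; apply: eq_bigr => k _; rewrite /= addnS.
Qed.

Lemma ev_mul_eq0 (w : nat -> W) p :
  (forall j, ev w (p * 'X^j) = 0) -> forall r, ev w (p * r) = 0.
Proof.
move=> wp; apply: linear_poly0 => // c q r.
by rewrite mulrDr -scalerAr linearP.
Qed.

(** Only the negative powers of u in q(u) f(u) constrain [q]. The constant [c] enters the polynomial
    part alone, and that part defines [P]. *)
Lemma regular_gen_seriesP (c : W) (h : F) (w : nat -> W) z : h != 0 ->
  regular_at (gen_series c h w) z <->
  exists2 q, ~~ root q z & forall r, ev w (q * r) = 0.
Proof.
move=> h0; set f := gen_series c h w.
have fE (q : {poly F}) j :
    \sum_(k < size q) q`_k *: f (k + j.+1)%N = h *: ev w (q * 'X^j).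
  rewrite evMXn /ev scaler_sumr; apply: eq_bigr => k _.
  by rewrite addnS /= !scalerA mulrC.
split=> [[P [q [qP qz]]]|[q qz qw]].
  exists q => //; apply: ev_mul_eq0 => j; have [_ /eqP] := qP j.
  by rewrite fE scaler_eq0 (negPf h0) => /eqP.
pose P j := \sum_(k < size q | (j <= k)%N) q`_k *: f (k - j)%N.
exists (mkseq P (size q)), q.
split=> // j; split; last by rewrite fE qw scaler0.
have [lt_j|le_j] := ltnP j (size q); first by rewrite nth_mkseq.
rewrite nth_default ?size_mkseq // big_pred0 // => k.
by rewrite leqNgt (leq_trans (ltn_ord k)).
Qed.

End GenSeries.

(** * Representations of the Yangian and their q-characters *)

Section Representation.
Variables (F : numClosedFieldType) (K : cartanData F) (hbar : F).
Variables (V : vectType F) (rho : representation (yangian K hbar) V).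

Lemma repZ c (t : yangian K hbar) v : rho (c%:A * t) v = c *: rho t v.
Proof. by rewrite mulr_algl linearZ scale_lfunE. Qed.

Lemma repM (s t : yangian K hbar) v : rho (s * t) v = rho s (rho t v).
Proof. by rewrite rep_M comp_lfunE. Qed.

Lemma repD (s t : yangian K hbar) v : rho (s + t) v = rho s v + rho t v.
Proof. by rewrite linearD add_lfunE. Qed.

Lemma rep_comm (i j : cd_index K) r s v :
  rho (y_xi i r) (rho (y_xi j s) v) = rho (y_xi j s) (rho (y_xi i r) v).
Proof.
have := congr1 (fun t => rho t v) (yangian_rel (yrel_xixi hbar i j r s)).
rewrite /= scale0r linear0 zero_lfunE !(repZ, repD, repM) scaleN1r => /eqP.
by rewrite subr_eq0 => /eqP.
Qed.

Lemma rep_rank_one (i : cd_index K) :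
  rank_one (cd_d i * cd_a i i) (hbar * (cd_d i * cd_a i i / 2))
    (fun r => rho (y_xi i r)) (fun b r => rho (y_x b i r)).
Proof.
split.
- by move=> r s v; exact: rep_comm.
- move=> b s v.
  have := congr1 (fun t => rho t v) (yangian_rel (yrel_xi0x hbar b i i s)).
  by rewrite /= !(repZ, repD, repM) scaleN1r.
- move=> b r s v.
  have := congr1 (fun t => rho t v) (yangian_rel (yrel_xix hbar b i i r s)).
  by rewrite /= !(repZ, repD, repM) !scaleN1r => ->; rewrite !mulrA.
- move=> b r s v.
  have := congr1 (fun t => rho t v) (yangian_rel (yrel_xx hbar b i i r s)).
  by rewrite /= !(repZ, repD, repM) !scaleN1r => ->; rewrite !mulrA.
- move=> r s v.
  have := congr1 (fun t => rho t v) (yangian_rel (yrel_xpxm hbar i i r s)).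
  by rewrite /= eqxx /= !(repZ, repD, repM) !scaleN1r.
Qed.

Definition joint_eigen (i : cd_index K) (c : nat -> F) :=
  exists2 v : V, v != 0 & forall r, rho (y_xi i r) v = c r *: v.

(** A nonzero V[mu] contains a joint eigenvector. Conversely, a joint eigenspace of the xi_(i,r) for
    one [i] is stable under all xi_(j,s), so it contains a joint eigenvector of the whole family. *)
Lemma sigma_charP i z : sigma_char hbar (qchar rho) i z <->
  exists2 c, joint_eigen i c & poles (gen_series (1 : F^o) hbar c) z.
Proof.
pose A (ik : cd_index K * nat) : 'End(V) := rho (y_xi ik.1 ik.2).
have commA ik jl v : A ik (A jl v) = A jl (A ik v) by exact: rep_comm.
split=> [[mu mu0 pz]|[c [v v0 xv] pz]].
  have [v v0 vmu] : exists2 v, v != 0 & v \in weight_space rho mu.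
    exists (vpick (weight_space rho mu)); last exact: memv_pick.
    rewrite vpick0 -dimv_eq0; apply: contra_notN mu0 => /eqP dim0.
    by rewrite /qchar dim0.
  have lin : lin_closed (fun v => v \in weight_space rho mu).
    by move=> c u w uU wU; rewrite memvD // memvZ.
  have stab ik : stable (A ik) (fun v => v \in weight_space rho mu).
    move=> w /gen_eigenP gw; apply/gen_eigenP => jl; have [N [N0 wN]] := gw jl.
    exists N; split=> //.
    rewrite -(iter_intertwine (f := A ik)
      (g := (A jl - mu jl.1 jl.2 *: \1)%VF)).
      by rewrite wN linear0.
    by move=> u; lfun_expand; rewrite commA.
  have [c [w [wU w0 Aw]]] := joint_eigenvector commA stab lin vmu v0.
  exists (mu i) => //; exists w => // r; rewrite (Aw (i, r)); congr (_ *: _).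
  have /gen_eigenP/(_ (i, r)) [N [_]] := wU.
  have -> : iter N
      (rho (y_xi (i, r).1 (i, r).2) - mu (i, r).1 (i, r).2 *: \1)%VF w =
      (c (i, r) - mu i r) ^+ N *: w.
    elim: N => [|N IHN]; first by rewrite scale1r.
    rewrite iterS IHN lfunZ; lfun_expand; rewrite (Aw (i, r)) -scalerBl scalerA.
    by rewrite exprSr.
  move=> /eqP; rewrite scaler_eq0 (negPf w0) orbF expf_eq0 subr_eq0.
  by case/andP => _ /eqP.
have [||c' [w [xw w0 Aw]]] := joint_eigenvector (A := A)
  (P := fun w => forall r, rho (y_xi i r) w = c r *: w) commA _ _ xv v0.
- by move=> ik w xw r; rewrite rep_comm xw linearZ.
- by move=> k u w xu xw r; rewrite linearP /= xu xw scalerDr !scalerA mulrC.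
pose mu : ell_weight K := fun j r => c' (j, r).
have muE : mu i = c.
  apply/funext => r; have := Aw (i, r); rewrite /A /= xw => /eqP.
  by rewrite -subr_eq0 -scalerBl scaler_eq0 (negPf w0) orbF subr_eq0 => /eqP.
exists mu; last by rewrite muE.
rewrite /= /qchar => /eqP; rewrite eqz_nat dimv_eq0 => /eqP U0.
have : w \in weight_space rho mu.
  apply/gen_eigenP => -[j r]; exists 1%N; split=> //=.
  by lfun_expand; rewrite (Aw (j, r)) subrr.
by rewrite U0 memv0 (negPf w0).
Qed.

Lemma sigma_mod_sigma_char (R : realFieldType) (ell : {additive F -> R}) i :
    hbar != 0 -> cd_d i * cd_a i i != 0 ->
    ell (hbar * (cd_d i * cd_a i i / 2)) = 1 ->
  sigma_mod rho i = sigma_char hbar (qchar rho) i.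
Proof.
move=> hbar0 e0 ell1; have sys := rep_rank_one i.
set xi := fun r => rho (y_xi i r) in sys.
set x := fun b r => rho (y_x b i r) in sys.
have ev_eigen c v p : (forall r, xi r v = c r *: v) ->
    ev xi p v = (ev (c : nat -> F^o) p : F) *: v.
  move=> xiv; rewrite /ev sum_lfunE scaler_suml; apply: eq_bigr => k _.
  by rewrite scale_lfunE xiv scalerA.
(* A denominator of xi_i(u) on V is one for each eigenvalue. *)
apply/seteqP; split=> z; last first.
  move=> /sigma_charP[c [v v0 xv] pz]; left; left => reg; apply: pz.
  have [q qz qxi] := (regular_gen_seriesP _ _ _ hbar0).1 reg.
  apply/(regular_gen_seriesP _ _ _ hbar0); exists q => // r; apply/eqP.
  rewrite -[_ == 0]orbF -(negPf v0) -scaler_eq0 -(ev_eigen _ _ _ xv).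
  by rewrite [ev xi _]qxi zero_lfunE.
move=> sz; apply: contrapT => nochar.
have creg c : joint_eigen i c -> exists2 q, ~~ root q z &
    forall r, ev (c : nat -> F^o) (q * r) = 0.
  move=> xc; apply: contrapT => noq; apply: nochar; apply/sigma_charP.
  by exists c => // /(regular_gen_seriesP _ _ _ hbar0).
have [m m0 mA] := annih_exists e0 sys.
have [k [g]] := multiplicity_XsubC m z; rewrite m0 /= => gz mE.
(* An eigenvector of [Xi (g * r)] can be chosen joint for the xi_s. Its eigenvalue series is regular
   at [z], and [g] cancels the poles elsewhere, so the eigenvalue is 0. *)
have nilp r v : exists k, iter k (ev xi (g * r)) v = 0.
  apply: nilpotent_of_eigenvalues => lam w w0 xw.
  have comm s u : ev xi (g * r) (xi s u) = xi s (ev xi (g * r) u).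
    rewrite /ev !sum_lfunE linear_sum; apply: eq_bigr => j _.
    by rewrite !scale_lfunE linearZ /= (r1_xixi sys).
  have [||c [v' [xv' v'0 Aw]]] := joint_eigenvector (A := xi)
    (P := fun w => ev xi (g * r) w = lam *: w) (r1_xixi sys) _ _ xw w0.
  - by move=> s u xu; rewrite comm xu linearZ.
  - by move=> t u u' xu xu'; rewrite linearP /= xu xu' scalerDr !scalerA mulrC.
  have [|q qz cq] := creg c; first by exists v'.
  pose J p := forall s, ev (c : nat -> F^o) (p * s) = 0.
  have Jgr : J (g * r).
    apply: (@coprime_ideal _ J _ q (('X - z%:P) ^+ k)).
    - by move=> p p' Jp Jp' s; rewrite mulrDl linearD /= Jp Jp' addr0.
    - by move=> p p' Jp s; rewrite -mulrA.
    - by rewrite coprimep_expr // coprimep_XsubC.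
    - by move=> s; rewrite [_ * q]mulrC -mulrA.
    move=> s; apply/eqP; rewrite -[_ == 0]orbF -(negPf v'0) -scaler_eq0.
    rewrite -(ev_eigen _ _ _ Aw) [g * r * _]mulrAC -mE.
    rewrite (annih_Xi sys) ?zero_lfunE //.
    by do 2!apply: annihM.
  have := ev_eigen _ _ (g * r) Aw; rewrite xv' -[g * r]mulr1 Jgr scale0r => /eqP.
  by rewrite scaler_eq0 (negPf v'0) orbF => /eqP.
have [q qz qA] := nilpotent_regular e0 ell1 sys gz nilp.
case: sz => [[|]|]; apply; apply/(regular_gen_seriesP _ _ _ hbar0); exists q => // r.
- by apply: (annih_Xi sys); exact: annihM.
- exact: qA.
- exact: qA.
Qed.

End Representation.

Theorem theorem6p1 (R : realType) (g : simpleLie R[i]) (hbar : R[i])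
    (hbar_neq0 : hbar != 0) (V : vectType R[i])
    (rho : representation (yangian (cartan_of g) hbar) V) :
  forall i : cd_index (cartan_of g),
    sigma_mod rho i = sigma_char hbar (qchar rho) i /\
    sigma_char hbar (qchar rho) i =
      sigma_char (cd_d i * hbar) (qchar (pullback (yangian_phi hbar i) rho)) tt.
Proof.
move=> i; have d0 := cartan_d_neq0 i; have a2 := cartan_aii i.
pose kap := hbar * (cd_d i * cd_a i i / 2).
have kap0 : kap != 0 by rewrite /kap a2 mulfK ?pnatr_eq0 // mulf_neq0.
split.
  (* As a_ii = 2, [kap] is d_i hbar, which is nonzero. *)
  apply: (@sigma_mod_sigma_char _ _ _ _ _ _ (re_div kap)) => //.
    by rewrite a2 mulf_neq0 // pnatr_eq0.
  by rewrite /= /re_div mulfV.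
have phi_xi r v : pullback (yangian_phi hbar i) rho
    (y_xi (K := cartan_sl2 R[i]) tt r) v =
    (cd_d i)^-1 *: rho (y_xi i r) v.
  by rewrite -scale_lfunE -linearZ -(phiE_xi hbar d0 a2 r).
(* Eigenvalues are divided by d_i while the parameter is multiplied by d_i, so the series agree. *)
have series (c : nat -> R[i]) : gen_series (1 : R[i]^o) (cd_d i * hbar)
    (fun r => (cd_d i)^-1 * c r) = gen_series (1 : R[i]^o) hbar c.
  apply/funext => -[//|r] /=.
  by rewrite /GRing.scale /= mulrA [cd_d i * _]mulrC mulfK.
apply/seteqP; split=> z /sigma_charP[c [v v0 xv] pz]; apply/sigma_charP.
  exists (fun r => (cd_d i)^-1 * c r); last by rewrite series.
  by exists v => // r; rewrite phi_xi xv scalerA.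
exists (fun r => cd_d i * c r).
  by exists v => // r; rewrite -scalerA -xv phi_xi scalerA divff // scale1r.
rewrite -series; rewrite (_ : (fun r => _) = c) //.
by apply/funext => r; rewrite mulKf.
Qed.
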